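(* Let $\mathcal{G}:(1,2]\to\mathbb{R}$ be defined by $\mathcal{G}(m)=\mathcal{G}(\{0,1,m\})$, let $\mathfrak{M}:=\{m\in(1,2]:\mathcal{G}(m)=1+\sqrt m\}$, and let $\{\mu_\sigma:\sigma\in S^*\}$ be the countable set defined in the context. Then $\mathcal{G}$ is differentiable at every point of $(1,2]\setminus(\mathfrak{M}\cup\{\mu_\sigma:\sigma\in S^*\})$. Its derivative is unbounded, and the total variation of $\mathcal{G}$ on $(1,2]$ is less than $2$.
   Context: For an alphabet (finite set of reals) $A$ with minimum $a_0$ and maximum $a_d$, and $\beta>1$: a $\beta$-expansion of $x$ over $A$ is a sequence $(u_k)_{k\ge1}\in A^{\mathbb{N}}$ with $x=\sum_{k\ge1}u_k\beta^{-k}$; $\mathcal{U}_\beta(A)$ is the set of sequences $(u_k)\in A^{\mathbb{N}}$ such that $\sum_k u_k\beta^{-k}$ has a unique $\beta$-expansion; the generalised golden ratio $\mathcal{G}(A)>1$ is the unique number such that $\mathcal{U}_\beta(A)=\{\overline{a_0},\overline{a_d}\}$ (constant sequences) for $\beta\in(1,\mathcal{G}(A))$ and $\mathcal{U}_\beta(A)$ contains another element for all $\beta>\mathcal{G}(A)$. For $h\ge0$ let $\tau_h$ be the substitution on $\{0,1\}$ with $\tau_h(0)=0^{h+1}1$, $\tau_h(1)=0^h1$, extended to finite and infinite words by concatenation. Let $S=\{\tau_h:h\ge0\}$ and $S^*$ the set of all finite compositions of elements of $S$ (including the identity). For $\sigma\in S^*$ write $\tilde u_0^{(\sigma)}\tilde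 u_1^{(\sigma)}\cdots=\sigma(0\overline{1})$ and $u_0^{(\sigma)}u_1^{(\sigma)}\cdots=\sigma(\overline{1})$, where $\overline 1=111\cdots$. Define $\beta_\sigma\ge2$ implicitly by $1+\sum_{k\ge1}\tilde u_k^{(\sigma)}\beta_\sigma^{-k}=(\beta_\sigma-1)\big(1+\sum_{k\ge0}u_k^{(\sigma)}\beta_\sigma^{-k-1}\big)$, and set $\mu_\sigma:=1+\sum_{k\ge1}\tilde u_k^{(\sigma)}\beta_\sigma^{-k}$. *)

(* Defs.v *)
From HB Require Import structures.
From mathcomp Require Import all_boot all_order all_algebra.
From mathcomp Require Import all_classical all_reals all_analysis.

Set Implicit Arguments.
Unset Strict Implicit.
Unset Printing Implicit Defensive.

Import Order.TTheory GRing.Theory Num.Theory.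
Import numFieldTopology.Exports numFieldNormedType.Exports.

Local Open Scope classical_set_scope.
Local Open Scope ring_scope.

Section GeneralisedGoldenRatio.
Variable R : realType.
Implicit Types (A : set R) (b g x m : R) (u v : nat -> R).

(* Sequences (u_k)_{k >= 1} are shifted: [u k] is the digit of index k + 1.
   Digit sequences are bounded, so these series converge when 1 < b. *)
Definition expansion_value b u : R := limn (series (fun k => u k / b ^+ k.+1)).

Definition is_expansion b A x u : Prop :=
  (forall k, A (u k)) /\ x = expansion_value b u.

Definition unique_expansions b A : set (nat -> R) :=
  [set u | (forall k, A (u k)) /\
           forall v, is_expansion b A (expansion_value b u) v -> v = u].

(* An alphabet is finite and nonempty, so [inf A] and [sup A] are its minimum
   a_0 and its maximum a_d. *)
Definition trivial_expansions A : set (nat -> R) :=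
  [set (fun=> inf A); (fun=> sup A)].

Definition is_golden_ratio A g : Prop :=
  [/\ 1 < g,
      forall b, 1 < b < g -> unique_expansions b A = trivial_expansions A &
      forall b, g < b -> exists2 u,
        unique_expansions b A u & ~ trivial_expansions A u].

Lemma is_golden_ratio_uniq A g g' :
  is_golden_ratio A g -> is_golden_ratio A g' -> g = g'.
Proof.
suff H h h' : is_golden_ratio A h -> is_golden_ratio A h' -> h <= h'.
  by move=> Ag Ag'; apply/eqP; rewrite eq_le !H.
move=> [_ Ah _] [h'1 _ Ah']; rewrite leNgt; apply/negP => h'h.
have [u + nu] := Ah' _ (midf_lt h'h).1.
by rewrite Ah ?(midf_lt h'h).2 ?(lt_trans h'1 (midf_lt h'h).1).
Qed.

(* [xget 0 P] is an element of P if there is one: the (unique) generalised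
   golden ratio of A. *)
Definition golden_ratio A : R := xget 0 (is_golden_ratio A).

Definition G m : R := golden_ratio [set 0; 1; m].

Definition frakM : set R := [set m | 1 < m <= 2 /\ G m = 1 + Num.sqrt m].

End GeneralisedGoldenRatio.

(* Letters are booleans, with 0 = false and 1 = true. *)
Definition substitution := bool -> seq bool.

Definition subst_word (s : substitution) (w : seq bool) : seq bool :=
  flatten (map s w).

(* If s is non-erasing, then the images of the first n.+1 letters of w have
   total length at least n.+1, hence contain the letter of index n of the
   infinite concatenation s (w 0) ++ s (w 1) ++ ... *)
Definition subst_inf (s : substitution) (w : nat -> bool) : nat -> bool :=
  fun n => nth false (subst_word s (mkseq w n.+1)) n.

Definition subst_id : substitution := fun a => [:: a].

Definition subst_comp (s t : substitution) : substitution :=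
  fun a => subst_word s (t a).

Definition tau (h : nat) : substitution :=
  fun a => if a then rcons (nseq h false) true else rcons (nseq h.+1 false) true.

Definition Sstar : set substitution :=
  [set foldr subst_comp subst_id (map tau hs) | hs in [set: seq nat]].

Lemma Sstar_nonerasing s : Sstar s -> forall a, (0 < size (s a))%N.
Proof.
move=> [hs _ <-]; elim: hs => [|h hs IH] a //=.
rewrite /subst_comp /subst_word; case: foldr (IH a) => // c t _ /=.
by rewrite size_cat /tau; case: c; rewrite size_rcons.
Qed.

Lemma subst_infP s w n : (forall a, (0 < size (s a))%N) ->
  subst_word s (mkseq w n) =
  mkseq (subst_inf s w) (size (subst_word s (mkseq w n))).
Proof.
move=> s0.
have S p : (p <= size (subst_word s (mkseq w p)))%N.
  elim: p => // p IH; rewrite /subst_word mkseqS map_rcons -cats1 flatten_cat.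
  by rewrite size_cat /= cats0 -addn1 leq_add.
have C p q : exists t, subst_word s (mkseq w (p + q)) =
                       subst_word s (mkseq w p) ++ t.
  rewrite /subst_word /mkseq iotaD !map_cat flatten_cat.
  by eexists; reflexivity.
apply: (@eq_from_nth _ false); first by rewrite size_mkseq.
move=> i ilt; rewrite nth_mkseq // /subst_inf.
case: (leqP n i.+1) => [ni|/ltnW ni].
  by have [t] := C n (i.+1 - n)%N; rewrite subnKC // => ->; rewrite nth_cat ilt.
have [t] := C i.+1 (n - i.+1)%N; rewrite subnKC // => ->.
by rewrite nth_cat S.
Qed.

Section Mu.
Variable R : realType.
Implicit Types (s : substitution) (b : R).

Definition u_word s : nat -> bool := subst_inf s (fun=> true).

Definition ut_word s : nat -> bool := subst_inf s (fun k => (0 < k)%N).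

(* The common left-hand side 1 + ~u_1 / b + ~u_2 / b^2 + ... ; the letter of
   index 0 does not occur in it. *)
Definition ut_sum s b : R :=
  1 + limn (series (fun k => (ut_word s k.+1)%:R / b ^+ k.+1)).

Definition is_beta s b : Prop :=
  2 <= b /\
  ut_sum s b =
  (b - 1) * (1 + limn (series (fun k => (u_word s k)%:R / b ^+ k.+1))).

Definition beta s : R := xget 0 (is_beta s).

Definition mu s : R := ut_sum s (beta s).

End Mu.

Section Variation.
Variable R : realType.

(* Total variation on an interval I that need not be closed: the supremum over
   all finite partitions a < ... < b with end points (hence all points) in I. *)
Definition total_variation_on (I : interval R) (f : R -> R) : \bar R :=
  ereal_sup [set x | exists a b s,
    [/\ a \in I, b \in I, itv_partition a b s & x = (variation a b f s)%:E]].

End Variation.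

(* Main.v *)
Require Import Defs.
From HB Require Import structures.
From mathcomp Require Import all_boot all_order all_algebra.
From mathcomp Require Import all_classical all_reals all_analysis.
From mathcomp Require Import zify ring lra.

Set Implicit Arguments.
Unset Strict Implicit.
Unset Printing Implicit Defensive.

Import Order.TTheory GRing.Theory Num.Theory.
Import numFieldTopology.Exports numFieldNormedType.Exports.

Local Open Scope classical_set_scope.
Local Open Scope ring_scope.

(* For b < 1 + sqrt m a nontrivial unique expansion over {0,1,m} has a tail w in
   {0,1}^N, and w is a unique expansion iff the value x of every tail that
   follows a letter 1 satisfies m/(b-1) - 1 < x < m - 1.  In lexicographic terms,
   as (b-1)^2 < m, every tail that follows a 0 exceeds every tail that follows a
   1, and the two already differ within a bounded number N of letters.  Such a
   w is, up to a shift, the image by some tau_h of a word with the same property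
   for N - 1, hence eventually equal to sigma(1^oo) for some sigma in S^*.  So b
   is admissible for m iff L(b) < m < U(b) for some sigma, where L is decreasing,
   U is increasing with slope at least 3/4, and L, U cross at (beta_sigma,
   mu_sigma); moreover the same sigma serves all smaller bases.  If
   G(m) < 1 + sqrt m, then near m the function G is the inverse of L when
   m < mu_sigma and the inverse of U when m > mu_sigma.  For sigma = tau_h the
   slope of L at beta_sigma = 2 tends to 0 as h grows, so G' is unbounded.

   The total variation of G is twice its increase since G(1+) = G(2) = 2.  The
   increase is at most 4/3 times the length of the set where G is not
   nonincreasing, and G is nonincreasing on [13/10, 4/3] and on [16/9, 2]. *)

(** * Words and substitutions *)

Section Sequences.
Variable T : Type.
Implicit Types (x y : seq T) (w : nat -> T).
Local Open Scope nat_scope.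

Definition stail k w : nat -> T := fun i => w (k + i).

Definition scons a w : nat -> T := fun i => if i is j.+1 then w j else a.

Definition prepend x w : nat -> T := foldr scons w x.

Lemma stail0 w : stail 0 w = w. Proof. by []. Qed.

Lemma stail_at0 k w : stail k w 0 = w k.
Proof. by rewrite /stail addn0. Qed.

Lemma stail_stail j k w : stail j (stail k w) = stail (k + j) w.
Proof. by apply/funext => i; rewrite /stail addnA. Qed.

Lemma scons_stail w : scons (w 0) (stail 1 w) = w.
Proof. by apply/funext => -[]. Qed.

Lemma prepend_cat x y w : prepend (x ++ y) w = prepend x (prepend y w).
Proof. exact: foldr_cat. Qed.

Lemma prependE d x w i :
  prepend x w i = if i < size x then nth d x i else w (i - size x).
Proof. by elim: x i => [|a x IH] [|i] //=; rewrite ?subn0 ?IH. Qed.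

Lemma stail_prepend x w k : stail (size x + k) (prepend x w) = stail k w.
Proof. by elim: x. Qed.

End Sequences.

(** * Images of infinite words under substitutions *)

Section InfiniteSubstitution.
Implicit Types (s t : substitution) (w : nat -> bool) (x : seq bool).
Local Open Scope nat_scope.

Definition nonerasing s := forall a, 0 < size (s a).

Lemma size_subst_word s x : nonerasing s -> size x <= size (subst_word s x).
Proof.
move=> s0; elim: x => //= a x IH.
by rewrite /subst_word /= size_cat -add1n leq_add.
Qed.

Lemma subst_infE s w : nonerasing s ->
  subst_inf s w = prepend (s (w 0)) (subst_inf s (stail 1 w)).
Proof.
move=> s0; apply/funext => i; rewrite (prependE false).
have E : mkseq w i.+1 = w 0 :: mkseq (stail 1 w) i.
  by rewrite /mkseq /= (iotaDl 1 0) -map_comp.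
rewrite {1}/subst_inf E /subst_word /= nth_cat; case: ltnP => // si.
have lti : i - size (s (w 0)) < i.
  by rewrite ltn_subrL s0 (leq_trans (s0 _) si).
rewrite -/(subst_word s _) subst_infP // nth_mkseq //.
by apply: (leq_trans lti); rewrite -{1}(size_mkseq (stail 1 w) i) size_subst_word.
Qed.

(** Blocks are nonempty, so a letter of [v i] lies in the block [s (w i)] or is a letter of smaller
    index of [v i.+1]. This recognises an image from its block decomposition. *)
Lemma subst_inf_unique s w (v : nat -> nat -> bool) : nonerasing s ->
  (forall i, v i = prepend (s (w i)) (v i.+1)) ->
  forall i, v i = subst_inf s (stail i w).
Proof.
move=> s0 H i; apply/funext => n.
elim/ltn_ind: n i => n IH i; rewrite H subst_infE // !(prependE false).
have -> : stail i w 0 = w i by rewrite /stail addn0.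
case: ltnP => // si; rewrite stail_stail addn1.
by rewrite IH // ltn_subrL s0 (leq_trans (s0 _) si).
Qed.

Lemma subst_inf_prepend s x w : nonerasing s ->
  subst_inf s (prepend x w) = prepend (subst_word s x) (subst_inf s w).
Proof.
move=> s0; elim: x => // a x IH.
by rewrite subst_infE //= /subst_word /= prepend_cat -IH.
Qed.

Lemma tau_nonerasing h : nonerasing (tau h).
Proof. by move=> [] /=; rewrite size_rcons. Qed.

Definition tau_inf h := subst_inf (tau h).

Definition sigma (hs : seq nat) : substitution :=
  foldr subst_comp subst_id (map tau hs).

Lemma sigma_nonerasing hs : nonerasing (sigma hs).
Proof. by apply: Sstar_nonerasing; exists hs. Qed.

Lemma subst_inf_sigma hs w : subst_inf (sigma hs) w = foldr tau_inf w hs.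
Proof.
suff H v : foldr tau_inf v hs =
    prepend (sigma hs (v 0)) (foldr tau_inf (stail 1 v) hs).
  rewrite -[w]stail0 -(@subst_inf_unique _ w (fun i => foldr tau_inf (stail i w) hs))//.
    exact: sigma_nonerasing.
  by move=> i; rewrite H stail_stail addn1 /stail addn0.
elim: hs => [|h hs IH] /=; first by rewrite scons_stail.
by rewrite IH /tau_inf subst_inf_prepend //; exact: tau_nonerasing.
Qed.

(** The word 0^n 1 w. Images of letters under tau_h have this shape, with n = h for 1 and n = h + 1
    for 0; hence the recurring [h + ~~ a]. *)
Definition block n w := prepend (nseq n false) (scons true w).

Lemma blockS n w : block n.+1 w = scons false (block n w).
Proof. by []. Qed.

Lemma stail_block n w : stail n.+1 (block n w) = w.
Proof.
rewrite /block; have := stail_prepend (nseq n false) (scons true w) 1.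
by rewrite size_nseq addn1 => ->.
Qed.

Lemma block_lt n w i : i < n -> block n w i = false.
Proof. by move=> lt; rewrite /block (prependE false) size_nseq lt nth_nseq lt. Qed.

Lemma block_eq n w : block n w n = true.
Proof. by rewrite /block (prependE false) size_nseq ltnn subnn. Qed.

Lemma tau_prepend h a w : prepend (tau h a) w = block (h + ~~ a) w.
Proof. by rewrite /block; case: a; rewrite /= ?addn1 ?addn0 -cats1 prepend_cat. Qed.

Lemma tau_infE h w : tau_inf h w = block (h + ~~ w 0) (tau_inf h (stail 1 w)).
Proof. by rewrite /tau_inf subst_infE ?tau_prepend //; exact: tau_nonerasing. Qed.

Lemma tau_inf_scons h a w : tau_inf h (scons a w) = block (h + ~~ a) (tau_inf h w).
Proof. by rewrite tau_infE. Qed.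

(** Both are (0^(h+1) 1)^oo; so the image of 0^oo is still of the form sigma(1^oo). *)
Lemma tau_inf_cst0 h : tau_inf h (fun=> false) = tau_inf h.+1 (fun=> true).
Proof.
apply: esym; rewrite -[RHS]/(tau_inf h (stail 0 (fun=> false))).
apply: (@subst_inf_unique _ _ (fun=> tau_inf h.+1 (fun=> true))) => [|_].
  exact: tau_nonerasing.
by rewrite tau_prepend {1}tau_infE /= addn0 addn1.
Qed.

(* [low hs] is sigma(1^oo), and [upp hs] is sigma(01^oo) without its first
   letter; they are the least and the greatest of the tails of sigma(1^oo) that
   follow a letter 1. *)
Definition low hs := foldr tau_inf (fun=> true) hs.

Fixpoint upp hs :=
  if hs is h :: hs' then tau_inf h (scons true (upp hs')) else fun=> true.

Lemma u_wordE hs : u_word (sigma hs) = low hs.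
Proof. exact: subst_inf_sigma. Qed.

(** Since tau_h(0) = 0 tau_h(1), removing the first 0 of tau_h(0v) leaves tau_h(1v), which is the
    recursion of [upp]. *)
Lemma ut_wordE hs : ut_word (sigma hs) = scons false (upp hs).
Proof.
rewrite /ut_word subst_inf_sigma.
elim: hs => [|h hs IH] /=; first by apply/funext => -[].
by rewrite IH !tau_inf_scons /= addn1 addn0.
Qed.

End InfiniteSubstitution.

(** * Lexicographic order and its behaviour under tau_h *)

Section Lexicographic.
Implicit Types (v w : nat -> bool).
Local Open Scope nat_scope.

Definition lexlt N v w := exists n,
  [/\ n < N, forall i, i < n -> v i = w i, v n = false & w n = true].

Definition lexle v w := v = w \/ exists N, lexlt N v w.

Lemma lexle_refl v : lexle v v. Proof. by left. Qed.

Lemma lexlt_le v w N : lexlt N v w -> lexle v w.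
Proof. by right; exists N. Qed.

Lemma lexlt_trans v w x M N : lexlt M v w -> lexlt N w x ->
  lexlt (maxn M N) v x.
Proof.
move=> [m [mM mE vm wm]] [n [nN nE wn xn]].
have [mn|nm|mn] := ltngtP m n; last by move: wn; rewrite -mn wm.
- exists m; split=> //; first by rewrite leq_max mM.
  + by move=> i im; rewrite mE // nE // (ltn_trans im).
  + by rewrite -nE.
- exists n; split=> //; first by rewrite leq_max nN orbT.
  + by move=> i im; rewrite mE ?nE // (ltn_trans im).
  + by rewrite mE.
Qed.

Lemma lexle_trans v w x : lexle v w -> lexle w x -> lexle v x.
Proof.
move=> [->//|[M vw]] [<-|[N wx]]; first exact: lexlt_le vw.
exact: lexlt_le (lexlt_trans vw wx).
Qed.

Lemma lexlt_scons a v w N :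
  lexlt N.+1 (scons a v) (scons a w) <-> lexlt N v w.
Proof.
split=> [[[|n] [nN nE vn wn]]|[n [nN nE vn wn]]].
- by rewrite /= in vn wn; rewrite vn in wn.
- by exists n; split=> // i /= im; have := nE i.+1 im.
- by exists n.+1; split=> // -[|i]//= im; rewrite nE.
Qed.

Lemma lexle_scons a v w : lexle (scons a v) (scons a w) <-> lexle v w.
Proof.
split=> -[E|[N vw]].
- by left; apply/funext => i; have := congr1 (fun f => f i.+1) E.
- case: N vw => [[n []]//|N /lexlt_scons]; exact: lexlt_le.
- by left; rewrite E.
- by right; exists N.+1; apply/lexlt_scons.
Qed.

Lemma lexlt_block n v w N :
  lexlt (n.+1 + N) (block n v) (block n w) <-> lexlt N v w.
Proof. by elim: n => [|n IH]; rewrite ?addSn ?blockS lexlt_scons. Qed.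

Lemma lexle_block n v w : lexle (block n v) (block n w) <-> lexle v w.
Proof. by elim: n => [|n IH]; rewrite ?blockS lexle_scons. Qed.

Lemma lexlt_block_gt m n v w : n < m -> lexlt n.+1 (block m v) (block n w).
Proof.
by move=> nm; exists n; split=> [|i im||]//;
  rewrite ?block_eq ?block_lt// (ltn_trans im).
Qed.

Lemma lexlt_block_le m n v w N : lexlt N (block m v) (block n w) -> n <= m.
Proof.
move=> [k [_ kE vk wk]]; rewrite leqNgt; apply/negP => mn.
have [km|mk|km] := ltngtP k m.
- by move: wk; rewrite block_lt // (ltn_trans km).
- by have := kE m mk; rewrite block_eq block_lt.
- by move: vk; rewrite km block_eq.
Qed.

Lemma lexle_block_ge m n v w : n <= m -> lexle v w ->
  lexle (block m v) (block n w).
Proof.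
rewrite leq_eqVlt => /predU1P[->|nm] vw; first exact/lexle_block.
exact: lexlt_le (lexlt_block_gt v w nm).
Qed.

(** As tau_h(0) has one more leading 0 than tau_h(1), the first differing letter decides. Images of
    letters are nonempty, so it occurs no later in the preimages, and [N] persists. *)
Lemma lexlt_tau_inf h v w N : lexlt N (tau_inf h v) (tau_inf h w) -> lexlt N v w.
Proof.
elim/ltn_ind: N v w => N IH v w; rewrite (tau_infE h v) (tau_infE h w).
move=> lt; have := lexlt_block_le lt; rewrite leq_add2l => vw0.
have [vw|vw] := eqVneq (v 0) (w 0).
  rewrite vw in lt; have [Nh|hN] := leqP N (h + ~~ w 0).
    have [n [nN _ _]] := lt; rewrite block_lt //; exact: leq_trans nN Nh.
  move: lt; rewrite -{1}(subnKC hN) lexlt_block => H.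
  have [|n [nN nE vn wn]] := IH _ _ _ _ H; first by rewrite ltn_subrL (leq_trans _ hN).
  rewrite -(scons_stail v) -(scons_stail w) vw.
  exists n.+1; split=> //; first by lia.
  by case=> // i /nE.
have {vw vw0} [v0 w0] : v 0 = false /\ w 0 = true.
  by case: (v 0) (w 0) vw vw0 => [] [].
by have [n [nN _ _ _]] := lt; exists 0; split=> //; exact: leq_trans nN.
Qed.

Lemma lexle_tau_inf h v w : lexle v w -> lexle (tau_inf h v) (tau_inf h w).
Proof.
move=> [->|[N]]; first exact: lexle_refl.
elim: N v w => [|N IH] v w; first by case=> n [].
rewrite -[v]scons_stail -[w]scons_stail !tau_inf_scons.
case vw : (v 0 == w 0).
  by rewrite (eqP vw) lexlt_scons lexle_block; exact: IH.
case: (v 0) vw; case: (w 0) => // _.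
  by case=> -[|n] [_ nE] //= _ _; have := nE 0 isT.
by move=> _; apply: lexlt_le; apply: lexlt_block_gt; rewrite /= addn0 addn1.
Qed.

End Lexicographic.

(** * Tails after a letter 1, and classification by desubstitution *)

Section Tails.
Implicit Types (v w : nat -> bool).
Local Open Scope nat_scope.

(* [v] is a tail of [w] that follows a letter 1. *)
Definition tail1 w v := exists2 k, w k = true & stail k.+1 w = v.

Lemma tail1_stail w k v : tail1 (stail k w) v -> tail1 w v.
Proof.
move=> [j wj <-]; exists (k + j) => //; by rewrite stail_stail addnS.
Qed.

Lemma tail1_block n w : tail1 (block n w) w.
Proof. by exists n; rewrite ?block_eq // stail_block. Qed.

Lemma tail1_trans u v w : tail1 u v -> tail1 v w -> tail1 u w.
Proof. by move=> [k _ <-]; apply: tail1_stail. Qed.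

Lemma tail1_tau_inf h w k : tail1 (tau_inf h w) (tau_inf h (stail k.+1 w)).
Proof.
elim: k w => [|k IH] w; rewrite tau_infE; first exact: tail1_block.
apply: tail1_trans (tail1_block _ _) _.
by have := IH (stail 1 w); rewrite stail_stail add1n.
Qed.

Lemma stail_tau_inf h w k : exists i j,
  j <= h + ~~ w i /\ stail k (tau_inf h w) = block j (tau_inf h (stail i.+1 w)).
Proof.
elim: k => [|k [i [[|j] [jh E]]]].
- by exists 0, (h + ~~ w 0); split=> //; rewrite stail0 tau_infE.
- exists i.+1, (h + ~~ w i.+1); split=> //.
  by rewrite -addn1 -stail_stail E (stail_block 0) tau_infE stail_stail addn1 /stail addn0.
- exists i, j; split; first exact: ltnW.
  by rewrite -addn1 -stail_stail E.
Qed.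

(** By induction: tau_h preserves the order, and fewer leading 0's make a word larger. A tail starts
    inside the image of a letter; restoring the 0's cut off bounds it below, deleting its leading
    0's bounds it above. *)
Lemma low_upp_bounds hs k :
  lexle (low hs) (stail k (low hs)) /\
  lexle (stail k (low hs)) (scons true (upp hs)).
Proof.
elim: hs k => [|h hs IH] k /=.
  by split; left; apply/funext => -[].
have [i [j [jh ->]]] := stail_tau_inf h (low hs) k.
rewrite -/(low hs); split.
  apply: lexle_trans (lexle_tau_inf h (IH i).1) _.
  rewrite tau_infE stail_stail addn1 /stail addn0.
  by apply: lexle_block_ge; first exact: jh; exact: lexle_refl.
by apply: (@lexle_block_ge _ 0) => //; apply/lexle_tau_inf; exact: (IH _).2.
Qed.

(** sigma(1^oo) is purely periodic, with a period that ends in a letter 1. *)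
Lemma tail1_low hs : tail1 (low hs) (low hs).
Proof.
elim: hs => [|h hs [k _ E]] /=; first by exists 0.
by rewrite -/(low hs) -{2}E; exact: tail1_tau_inf.
Qed.

Lemma low_recurrent hs k : exists j, stail (k + j) (low hs) = low hs.
Proof.
have [p _ E] := tail1_low hs.
have Ei i : stail (i * p.+1) (low hs) = low hs.
  by elim: i => // i IH; rewrite mulSn -stail_stail E.
by exists (k * p); rewrite -mulnS Ei.
Qed.

Lemma tail1_low_upp hs : tail1 (low hs) (upp hs).
Proof.
elim: hs => [|h hs [k wk E]] /=; first by exists 0.
have Ek : stail k (low hs) = scons true (upp hs).
  by rewrite -[LHS]scons_stail stail_stail addn1 E /stail addn0 wk.
have [p _ Ep] := tail1_low hs.
have -> : scons true (upp hs) = stail (p + k).+1 (low hs).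
  by rewrite -addSn -stail_stail Ep.
exact: tail1_tau_inf.
Qed.

Lemma tail1_low_bounds hs v : tail1 (low hs) v ->
  lexle (low hs) v /\ lexle v (upp hs).
Proof.
move=> [k wk <-]; split; first exact: (low_upp_bounds _ _).1.
rewrite -(lexle_scons true).
have -> : scons true (stail k.+1 (low hs)) = stail k (low hs).
  by rewrite -[RHS]scons_stail stail_stail addn1 /stail addn0 wk.
exact: (low_upp_bounds _ _).2.
Qed.

(* In particular a letter 0 and a letter 1 are never followed by the same N
   letters, so that N bounds the number of desubstitutions. *)
Definition gap N (X : set (nat -> bool)) := forall w w' i j,
  X w -> X w' -> w i = false -> w' j = true ->
  lexlt N (stail j.+1 w') (stail i.+1 w).

(** In a tail 0^oo, what follows the first 0 would by [gap] exceed a tail that follows a 1, hence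
    contain a 1. *)
Lemma infinite_ones_block N X w : gap N X -> X w ->
  (exists2 w', X w' & exists j, w' j = true) ->
  forall k, exists n, stail k w = block n (stail (k + n.+1) w).
Proof.
move=> gX Xw [w' Xw' [j w'j]] k.
have [n wn] : exists n, w (k + n).
  apply: contrapT => /forallNP H; have wk : w k = false.
    by have := H 0; rewrite addn0; case: (w k).
  have [n [_ _ _]] := gX _ _ _ _ Xw Xw' wk w'j.
  by rewrite /stail addSnnS; exact: H.
have [{wn}n wn min] := @ex_minnP (fun n => w (k + n)) (ex_intro _ n wn).
exists n; apply/funext => i; rewrite /stail.
have [lt|gt|->] := ltngtP i n.
- rewrite block_lt //; apply: contraTF lt => /min; lia.
- by have := congr1 (fun f => f (i - n.+1)) (stail_block n (fun i => w (k + n.+1 + i)));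
  rewrite /stail subnKC // => ->; congr w; lia.
- by rewrite block_eq.
Qed.

(* Two runs of 0's between 1's cannot differ by 2, so all tails that follow a 1
   are concatenations of 0^h 1 and 0^(h+1) 1. *)
Lemma gap_desubstitute N X : gap N X ->
  (exists2 w, X w & exists j, w j = true) ->
  exists h, forall w v, X w -> tail1 w v -> exists v', v = tau_inf h v'.
Proof.
move=> gX X1; have [w1 Xw1 [j1 w1j]] := X1.
have blk := infinite_ones_block gX _ X1.
pose Q v := exists2 w, X w & tail1 w v.
pose P n := `[< exists v, Q (block n v) >].
have [n Pn] : exists n, P n.
  have [n E] := blk _ Xw1 j1.+1.
  by exists n; apply/asboolP; exists (stail (j1.+1 + n.+1) w1), w1 => //; exists j1.
(* [h] is the least length of a run of 0's between two 1's. *)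
have [{Pn}h /asboolP[vh [wh Xwh [kh whk Eh]]] min] := @ex_minnP P (ex_intro _ n Pn).
pose nxt v := stail (h + ~~ v h).+1 v.
have step v : Q v -> v = block (h + ~~ v h) (nxt v) /\ Q (nxt v).
  move=> [w Xw [k wk Ev]]; have [n' E] := blk _ Xw k.+1.
  rewrite Ev in E.
  have hn : h <= n'.
    by apply: min; apply/asboolP; exists (stail (k.+1 + n'.+1) w), w => //; exists k;
      rewrite // Ev E.
  (* If n' >= h + 2, dropping the first 0 of the run leaves a tail that follows a 0 and starts with
     at least h + 1 zeros. It is smaller than the tail 0^h 1... that follows a 1, against [gap]. *)
  have nh : n' <= h.+1.
    rewrite leqNgt; apply/negP => lt; have n1 : n'.-1.+1 = n' by lia.
    have wk1 : w k.+1 = false.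
      have := congr1 (fun f => f 0) Ev; rewrite /stail addn0 => ->.
      by rewrite E block_lt //; lia.
    have := gX _ _ _ _ Xw Xwh wk1 whk; rewrite Eh.
    have -> : stail k.+2 w = block n'.-1 (stail (k.+1 + n'.+1) w).
      by rewrite -(addn1 k.+1) -stail_stail Ev E -n1.
    by move=> /lexlt_block_le; lia.
  have vE : h + ~~ v h = n'.
    rewrite E; move: hn; rewrite leq_eqVlt => /predU1P[<-|lt].
      by rewrite block_eq addn0.
    by rewrite block_lt //= addn1; lia.
  rewrite /nxt vE; rewrite {2}E stail_block; split=> //.
  exists w => //; exists (k.+1 + n') => //.
    have := congr1 (fun f => f n') Ev; rewrite {1}/stail => ->.
    by rewrite E block_eq.
  by rewrite -Ev stail_stail addnS.
exists h => w v Xw wv.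
pose vs i := iter i nxt v.
have Qs i : Q (vs i) by elim: i => [|i /step[]//]; exists w.
(* The letter of index h is 1 iff the leading block is 0^h 1 = tau_h(1). *)
exists (fun i => vs i h).
rewrite -[LHS]/(vs 0) -[fun i => vs i h]stail0.
apply: subst_inf_unique => [|i]; first exact: tau_nonerasing.
by rewrite tau_prepend; exact: (step _ (Qs i)).1.
Qed.

(** Induction on [N]. In the comparisons between images, once the first 0 of tau_h(0) is dropped,
    both words start with 0^h 1; removing this prefix lowers [N]. For N = 0 no comparison holds, so
    the letters 0 and 1 cannot both occur in X. *)
Lemma gap_classification N X : gap N X ->
  (forall w, X w -> w = fun=> false) \/
  (exists hs, forall w, X w -> exists k, stail k w = low hs).
Proof.
elim: N X => [|N IH] X gX.
  have [[w Xw [i wi]]|no0] := pselect (exists2 w, X w & exists i, w i = false).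
    left=> w' Xw'; apply/funext => j; case w'j : (w' j) => //.
    by have [n []] := gX _ _ _ _ Xw Xw' wi w'j.
  right; exists [::] => w Xw; exists 0; apply/funext => i.
  rewrite stail0; case wi : (w i) => //.
  by case: no0; exists w => //; exists i.
have [X1|no1] := pselect (exists2 w, X w & exists j, w j = true); last first.
  left=> w Xw; apply/funext => j; case wj : (w j) => //.
  by case: no1; exists w => //; exists j.
have [h desub] := gap_desubstitute gX X1.
pose X' : set (nat -> bool) := [set v | exists2 w, X w & tail1 w (tau_inf h v)].
have tailX' v k : X' v -> X' (stail k v).
  case: k => [|k] [w Xw wv]; first by exists w.
  exists w => //; apply: tail1_trans wv _; exact: tail1_tau_inf.
have XX' w : X w -> exists2 v, X' v & tail1 w (tau_inf h v).
  move=> Xw; have [n E] := infinite_ones_block gX Xw X1 0.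
  have w1 : tail1 w (stail n.+1 w).
    by exists n => //; have := congr1 (fun f => f n) E; rewrite stail0 block_eq.
  have [v Ev] := desub _ _ Xw w1.
  by exists v; [exists w; rewrite // -Ev|rewrite -Ev].
have gX' : gap N X'.
  move=> v v' i j X'v X'v' vi v'j.
  have [w Xw [k wk Ek]] := tailX' _ i X'v.
  have [w' Xw' [k' wk' Ek']] := tailX' _ j X'v'.
  apply: (@lexlt_tau_inf h).
  rewrite tau_infE stail_stail addn1 stail_at0 vi /= addn1 in Ek.
  rewrite tau_infE stail_stail addn1 stail_at0 v'j /= addn0 in Ek'.
  have wk1 : w k.+1 = false.
    by have := congr1 (fun f => f 0) Ek; rewrite /stail addn0.
  have := gX _ _ _ _ Xw Xw' wk1 wk'; rewrite Ek'.
  rewrite -(addn1 k.+1) -stail_stail Ek.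
  rewrite -[stail 1 _]/(block h (tau_inf h (stail i.+1 v))) => -[n [nN nE vn wn]].
  apply/(lexlt_block h); exists n; split=> //; lia.
right; have [X'0|[hs X'hs]] := IH _ gX'.
  exists [:: h.+1] => w /XX'[v /X'0 -> [k _ E]].
  by exists k.+1; rewrite E tau_inf_cst0.
exists (h :: hs) => w /XX'[v /X'hs[k Ev]] wv.
have [j _ E] : tail1 w (tau_inf h (low hs)).
  rewrite -Ev; case: k {Ev} => [//|k].
  by apply: tail1_trans wv _; exact: tail1_tau_inf.
by exists j.+1.
Qed.

End Tails.

(** * Unique expansions over a ternary alphabet *)

Section Values.
Variable R : realType.
Implicit Types (b m x y d : R) (u v : nat -> R).

Lemma exprV_small b e : 1 < b -> 0 < e -> exists n, (b ^+ n)^-1 < e.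
Proof.
move=> b1 e0; have b0 : 0 < b by lra.
have : `|b^-1| < 1 by rewrite gtr0_norm ?invr_gt0 // invf_lt1.
move=> /cvg_expr /cvgr0_norm_lt /(_ _ e0) [n _ /(_ n (leqnn _))] /=.
rewrite exprVn ger0_norm ?invr_ge0 ?exprn_ge0 ?(ltW b0) // => h.
by exists n.
Qed.

Lemma norm_le_expr_eq0 b x y : 1 < b -> (forall n, `|x| <= y / b ^+ n) -> x = 0.
Proof.
move=> b1 H; apply/eqP; rewrite -normr_eq0; apply/negPn/negP => x0.
have {}x0 : 0 < `|x| by rewrite lt_neqAle eq_sym x0 normr_ge0.
have y0 : 0 < y by have := H 0%N; rewrite expr0 divr1; lra.
have [|n] := @exprV_small b (`|x| / y) b1; first by rewrite divr_gt0.
by rewrite ltr_pdivlMr // mulrC ltNge H.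
Qed.

Section FixedBase.
Variables (b M : R).
Hypothesis b1 : 1 < b.

Let b0 : 0 < b. Proof. by rewrite (lt_trans _ b1). Qed.

Definition digits u := forall k, 0 <= u k <= M.

Lemma digits_stail u k : digits u -> digits (stail k u).
Proof. by move=> du i; exact: du. Qed.

Lemma is_cvg_expansion u : digits u ->
  cvgn (series (fun k => u k / b ^+ k.+1)).
Proof.
move=> du; have M0 : 0 <= M by have /andP[] := du 0%N; exact: le_trans.
apply: (@series_le_cvg _ _ (geometric (M / b) b^-1)) => [n|n|n|].
- by have /andP[? _] := du n; rewrite divr_ge0 // exprn_ge0 // ltW.
- by rewrite /geometric /= mulr_ge0 ?divr_ge0 ?exprn_ge0 ?invr_ge0 ?(ltW b0).
- rewrite /geometric /= exprVn -mulrA -invfM -exprS ler_pM2r ?invr_gt0 ?exprn_gt0 //.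
  by have /andP[] := du n.
- by apply: is_cvg_geometric_series; rewrite gtr0_norm ?invr_gt0 // invf_lt1.
Qed.

Lemma expansion_value_cons u : digits u ->
  expansion_value b u = (u 0%N + expansion_value b (stail 1 u)) / b.
Proof.
move=> du; apply: cvg_lim => //; rewrite -(cvg_shiftS (series _)).
have -> : (fun n => series (fun k => u k / b ^+ k.+1) n.+1) =
          (fun n => (u 0%N + series (fun k => stail 1 u k / b ^+ k.+1) n) / b).
  apply/funext => n; rewrite /series /= big_nat_recl // mulrDl expr1; congr (_ + _).
  rewrite mulr_suml; apply: eq_bigr => k _.
  by rewrite /stail add1n [b ^+ k.+2]exprSr invfM mulrA.
apply: cvgM (cvg_cst _); apply: cvgD; first exact: cvg_cst.
exact: is_cvg_expansion (digits_stail _ du).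
Qed.

Lemma le_expansion_value u v : digits u -> digits v ->
  (forall k, u k <= v k) -> expansion_value b u <= expansion_value b v.
Proof.
move=> du dv uv; apply: ler_lim; [exact: is_cvg_expansion..|].
apply: nearW => n; apply: ler_sum => k _.
by rewrite ler_pM2r ?invr_gt0 ?exprn_gt0.
Qed.

Lemma expansion_value_cst c : 0 <= c <= M ->
  expansion_value b (fun=> c) = c / (b - 1).
Proof.
move=> cM; have := @expansion_value_cons (fun=> c) (fun=> cM).
rewrite /stail; set x := expansion_value _ _ => /(congr1 ( *%R^~ b)).
rewrite divfK ?gt_eqF // => E.
by apply/(canRL (mulfK _)); [rewrite gt_eqF ?subr_gt0|lra].
Qed.

Lemma expansion_value_bounds u : digits u ->
  0 <= expansion_value b u <= M / (b - 1).
Proof.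
move=> du; have M0 : 0 <= M by have /andP[] := du 0%N; exact: le_trans.
rewrite -(@expansion_value_cst M) ?M0 ?lexx //.
have {1}-> : 0 = expansion_value b (fun=> 0).
  by rewrite expansion_value_cst ?lexx ?mul0r.
by apply/andP; split; apply: le_expansion_value => // k; rewrite ?M0 ?lexx //;
  have /andP[] := du k.
Qed.

Lemma expansion_value_agree u v n : digits u -> digits v ->
  (forall i, (i < n)%N -> u i = v i) ->
  `|expansion_value b u - expansion_value b v| <= M / (b - 1) / b ^+ n.
Proof.
elim: n u v => [|n IH] u v du dv uv.
  have := expansion_value_bounds du; have := expansion_value_bounds dv.
  rewrite expr0 divr1 ler_norml; lra.
rewrite (expansion_value_cons du) (expansion_value_cons dv) uv //.
rewrite -mulrBl opprD addrACA subrr add0r normrM normfV (gtr0_norm b0).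
rewrite exprSr invfM mulrA ler_pM2r ?invr_gt0 //.
by apply: IH => [||i iN]; [exact: digits_stail..|exact: uv].
Qed.

End FixedBase.

End Values.

(** * Unique expansions through forced letters *)

Section TernaryAlphabet.
Variable R : realType.
Implicit Types (b m x y d : R) (u v : nat -> R).

Definition ternary m : set R := [set 0; 1; m].

Lemma ternary_digits m u : 1 < m -> (forall k, ternary m (u k)) -> digits m u.
Proof. by move=> m1 Au k; have [[]|] := Au k => /= ->; lra. Qed.

(* The tails x that exclude any other first letter than d. *)
Definition forced m b d x : Prop :=
  [/\ d = 0 -> x < 1, d = 1 -> m / (b - 1) - 1 < x < m - 1
    & d = m -> m / (b - 1) - (m - 1) < x].

(** As long as the letters agree, so do the remaining values; by [forced], a different next letter
    would push the tail of v out of [0, m/(b-1)]. *)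
Lemma unique_expansionsI m b u : 1 < m <= 2 -> 1 < b ->
  (forall k, ternary m (u k)) ->
  (forall k, forced m b (u k) (expansion_value b (stail k.+1 u))) ->
  unique_expansions b (ternary m) u.
Proof.
move=> m12 b1 Au fu; have m1 : 1 < m by lra.
split=> // v [Av Euv].
suff H k : expansion_value b (stail k u) = expansion_value b (stail k v) /\
    (forall i, (i < k)%N -> u i = v i).
  by apply/funext => k; rewrite (H k.+1).2.
elim: k => [|k [IH IHk]]; first by [].
have du := digits_stail k (ternary_digits m1 Au).
have dv := digits_stail k (ternary_digits m1 Av).
have /(congr1 ( *%R^~ b)) := IH.
rewrite (expansion_value_cons b1 du) (expansion_value_cons b1 dv).
rewrite !divfK ?gt_eqF ?(lt_trans _ b1) // !stail_stail addn1 !stail_at0 => E.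
have := expansion_value_bounds b1 (digits_stail k.+1 (ternary_digits m1 Au)).
have := expansion_value_bounds b1 (digits_stail k.+1 (ternary_digits m1 Av)).
move: E (fu k) => /=; set X := expansion_value b _; set Y := expansion_value b _.
rewrite /forced; set K := m / (b - 1) => E fk Y0 X0.
have uvk : u k = v k.
  move: E fk; have [[|]|] := Au k => /= ->; have [[|]|] := Av k => /= -> // E [f0 f1 fm];
    do ?[have {}f0 := f0 erefl]; do ?[have {}f1 := f1 erefl];
    do ?[have {}fm := fm erefl]; lra.
split; first by move: E; rewrite uvk; lra.
by move=> i; rewrite ltnS leq_eqVlt => /predU1P[->|/IHk].
Qed.

Lemma expansion_exists m b x : 1 < m <= 2 -> 1 < b <= 1 + m ->
  0 <= x <= m / (b - 1) -> exists u, is_expansion b (ternary m) x u.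
Proof.
move=> m12 b1m x0; have b1 : 1 < b by lra.
have K1 : 1 <= m / (b - 1) by rewrite ler_pdivlMr; lra.
have bK : b * (m / (b - 1)) = m + m / (b - 1) by field; lra.
set K := m / (b - 1) in x0 K1 bK.
(* A greedy choice: as m - 1 <= 1 <= m/(b-1), the remainders stay in [0, m/(b-1)]. *)
pose d y := if b * y < 1 then 0 else if b * y < m then 1 else m.
pose y n := iter n (fun y => b * y - d y) x.
have yK n : 0 <= y n <= K.
  elim: n => [//|n]; rewrite -[y n.+1]/(b * y n - d (y n)); move: (y n) => z z0.
  have bz : 0 <= b * z <= m + K.
    rewrite mulr_ge0 ?(le_trans _ (ltW b1)) //=; last by lra.
    by rewrite -bK ler_pM2l; lra.
  by rewrite /d; case: ltP => z1; [lra|case: ltP => zm; lra].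
pose u n := d (y n).
have Au k : ternary m (u k).
  rewrite /u /d; case: ifP => _; first by left; left.
  by case: ifP => _; [left; right|right].
exists u; split=> //; have m1 : 1 < m by lra.
have du := ternary_digits m1 Au.
apply/eqP; rewrite -subr_eq0; apply/eqP.
apply: (@norm_le_expr_eq0 _ b _ K) => // n.
suff -> : x - expansion_value b u = (y n - expansion_value b (stail n u)) / b ^+ n.
  have bn : 0 < b ^+ n by rewrite exprn_gt0 // (lt_trans _ b1).
  rewrite normrM normfV (gtr0_norm bn) ler_pM2r ?invr_gt0 //.
  have := yK n; have := expansion_value_bounds b1 (digits_stail n du).
  by rewrite -/K ler_norml; lra.
elim: n => [|n ->]; first by rewrite expr0 divr1.
rewrite (expansion_value_cons b1 (digits_stail n du)) stail_stail addn1 stail_at0.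
rewrite exprS /= -/(y n) -/(u n); field.
by rewrite expf_neq0 //= gt_eqF // (lt_trans _ b1).
Qed.

Lemma unique_expansions_tail m b u k : 1 < m -> 1 < b ->
  unique_expansions b (ternary m) u ->
  unique_expansions b (ternary m) (stail k u).
Proof.
move=> m1 b1; elim: k => // k IH /IH[Au H]; rewrite -addn1 -stail_stail.
set w := stail k u in Au H *; split=> [i|v [Av E]]; first exact: Au.
have Asv i : ternary m (scons (w 0%N) v i) by case: i => [|i]; [exact: Au|exact: Av].
suff <- : scons (w 0%N) v = w by [].
apply: H; split=> //.
rewrite (expansion_value_cons b1 (ternary_digits m1 Au)).
by rewrite (expansion_value_cons b1 (ternary_digits m1 Asv)) E.
Qed.

Lemma unique_expansions_forced m b u k : 1 < m <= 2 -> 1 < b <= 1 + m ->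
  unique_expansions b (ternary m) u ->
  forced m b (u k) (expansion_value b (stail k.+1 u)).
Proof.
move=> m12 b1m; have b1 : 1 < b by lra. have m1 : 1 < m by lra.
move=> /(unique_expansions_tail k m1 b1).
rewrite -addn1 -stail_stail; have -> : u k = stail k u 0%N by rewrite /stail addn0.
move: (stail k u) => {}u [Au H].
have du := ternary_digits m1 Au.
set X := expansion_value b (stail 1 u).
have XK : 0 <= X <= m / (b - 1) by exact/expansion_value_bounds/digits_stail.
(* Another first letter d would be possible if X + u 0 - d were a value. *)
have alt d : ternary m d -> d <> u 0%N ->
    ~ (0 <= X + u 0%N - d <= m / (b - 1)).
  move=> Ad du0 /(expansion_exists m12 b1m)[v [Av E]].
  have Asv i : ternary m (scons d v i) by case: i.
  suff /(congr1 (fun f => f 0%N)) : scons d v = u by [].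
  apply: H; split=> //.
  rewrite (expansion_value_cons b1 du) (expansion_value_cons b1 (ternary_digits m1 Asv)).
  by rewrite -[stail 1 (scons d v)]/v -E -/X /=; congr (_ / b); lra.
set K := m / (b - 1) in XK alt *.
have K1 : 1 <= K by rewrite /K ler_pdivlMr; lra.
rewrite /forced -/K; clearbody X K; split=> E; rewrite E in alt.
- rewrite ltNge; apply/negP => X1; apply: (alt 1); [by left; right|by move=> ?; lra|lra].
- apply/andP; split; rewrite ltNge; apply/negP => X1.
  + by apply: (alt 0); [left; left|by move=> ?; lra|lra].
  + by apply: (alt m); [right|by move=> ?; lra|lra].
- by rewrite ltNge; apply/negP => X1; apply: (alt 1); [left; right|by move=> ?; lra|lra].
Qed.

Lemma trivial_expansions_ternary m : 1 < m ->
  trivial_expansions (ternary m) = [set (fun=> 0); (fun=> m)].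
Proof.
move=> m1; rewrite /trivial_expansions.
have A0 : ternary m 0 by left; left.
have Am : ternary m m by right.
have -> : inf (ternary m) = 0.
  apply/eqP; rewrite eq_le; apply/andP; split.
    by apply: ge_inf => //; exists 0 => x Ax; have [[]|] := Ax => /= ->; lra.
  by apply: lb_le_inf; [exists 0|move=> x Ax; have [[]|] := Ax => /= ->; lra].
suff -> : sup (ternary m) = m by [].
apply/eqP; rewrite eq_le; apply/andP; split.
  by apply: ge_sup; [exists 0|move=> x Ax; have [[]|] := Ax => /= ->; lra].
by apply: ub_le_sup => //; exists m => x Ax; have [[]|] := Ax => /= ->; lra.
Qed.

Lemma trivial_expansions_unique m b : 1 < m <= 2 -> 1 < b <= 1 + m ->
  trivial_expansions (ternary m) `<=` unique_expansions b (ternary m).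
Proof.
move=> m12 b1m; have m1 : 1 < m by lra.
have b1 : 1 < b by lra.
have K1 : 1 <= m / (b - 1) by rewrite ler_pdivlMr; lra.
rewrite trivial_expansions_ternary // => u [] ->.
- apply: unique_expansionsI => // k; first by left; left.
  by rewrite /stail (@expansion_value_cst _ _ m) ?mul0r; [split; lra|lra|lra].
- apply: unique_expansionsI => // k; first by right.
  by rewrite /stail (@expansion_value_cst _ _ m); [split; lra|lra|lra].
Qed.

End TernaryAlphabet.

(** * Admissible binary sequences *)

Section BinaryValues.
Variable R : realType.
Implicit Types (b c m x : R) (v w : nat -> bool).

Definition wval b w : R := expansion_value b (fun k => (w k)%:R).

Lemma bool_digits w : digits 1 (fun k => (w k)%:R : R).
Proof. by move=> k; case: (w k); rewrite /= ?lexx ?ler01. Qed.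

Lemma wval_cons b w : 1 < b -> wval b w = ((w 0%N)%:R + wval b (stail 1 w)) / b.
Proof. by move=> b1; rewrite /wval (expansion_value_cons b1 (bool_digits w)). Qed.

Lemma wval_tail b w k : 1 < b ->
  wval b (stail k.+1 w) = b * wval b (stail k w) - (w k)%:R.
Proof.
move=> b1; rewrite (wval_cons (stail k w) b1) stail_stail addn1 stail_at0; field.
by rewrite gt_eqF // (lt_trans _ b1).
Qed.

Lemma wval_bounds b w : 1 < b -> 0 <= wval b w <= 1 / (b - 1).
Proof. by move=> b1; exact: expansion_value_bounds (bool_digits w). Qed.

Lemma wval_agree b v w n : 1 < b -> (forall i, (i < n)%N -> v i = w i) ->
  `|wval b v - wval b w| <= 1 / (b - 1) / b ^+ n.
Proof.
move=> b1 vw; apply: (expansion_value_agree b1 (bool_digits v) (bool_digits w)).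
by move=> i /vw ->.
Qed.

Lemma wval_cst0 b : 1 < b -> wval b (fun=> false) = 0.
Proof.
by move=> b1; rewrite /wval (@expansion_value_cst _ b 1) ?mul0r //= lexx ler01.
Qed.

(** At the first difference w gains 1, and the later letters take back at most 1/(b-1). *)
Lemma wval_lexlt_diff b v w N : 1 < b -> lexlt N v w ->
  exists n, (1 - 1 / (b - 1)) / b ^+ n.+1 <= wval b w - wval b v.
Proof.
move=> b1 [n [_ + vn wn]]; have b0 : 0 < b by lra.
move=> vw; exists n.
elim: n v w vn wn vw => [|n IH] v w vn wn vw;
  rewrite (wval_cons v b1) (wval_cons w b1) -mulrBl.
  rewrite expr1 ler_pM2r ?invr_gt0 // vn wn.
  have /andP[_ v1] := wval_bounds (stail 1 v) b1.
  have /andP[w0 _] := wval_bounds (stail 1 w) b1.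
  by rewrite /=; lra.
rewrite exprSr invfM mulrA ler_pM2r ?invr_gt0 // vw // opprD addrACA subrr add0r.
by apply: IH => // i iN; exact: vw.
Qed.

Lemma wval_lexlt b v w N : 2 < b -> lexlt N v w -> wval b v < wval b w.
Proof.
move=> b2 vw; have b1 : 1 < b by lra.
have [n] := wval_lexlt_diff b1 vw.
have : 0 < (1 - 1 / (b - 1)) / b ^+ n.+1; last lra.
rewrite divr_gt0 ?exprn_gt0 //; last lra.
by rewrite subr_gt0 ltr_pdivrMr; lra.
Qed.

Lemma wval_lexle b v w : 2 <= b -> lexle v w -> wval b v <= wval b w.
Proof.
move=> b2 [->//|[N vw]]; have b1 : 1 < b by lra.
have [n] := wval_lexlt_diff b1 vw.
have : 0 <= (1 - 1 / (b - 1)) / b ^+ n.+1; last lra.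
rewrite divr_ge0 ?exprn_ge0 //; last lra.
by rewrite subr_ge0 ler_pdivrMr; lra.
Qed.

Lemma lexlt_wval b v w N : 2 < b ->
  1 / (b - 1) / b ^+ N < wval b w - wval b v -> lexlt N v w.
Proof.
move=> b2 vw; have b1 : 1 < b by lra.
have [n [nN vwn]] : exists n, (n < N)%N /\ v n != w n.
  apply: contrapT => /forallNP H; move: vw; rewrite ltNge => /negP; apply.
  apply: le_trans (ler_norm _) (wval_agree b1 _) => i iN.
  by apply/eqP; rewrite eq_sym; apply: contrapT => /negP ?; exact: (H i).
have [k vwk min] := @ex_minnP (fun n => v n != w n) (ex_intro _ n vwn).
have kN : (k < N)%N by apply: leq_ltn_trans nN; apply: min.
have agree i : (i < k)%N -> v i = w i.
  move=> ik; apply/eqP; apply: contraTT ik => /min; by rewrite -leqNgt.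
have [vk wk] : v k = false /\ w k = true; last by exists k.
case vk : (v k) vwk; case wk : (w k) => // _.
have /(wval_lexlt b2) wv : lexlt N w v by exists k; split=> // i /agree.
have : 0 < 1 / (b - 1) / b ^+ N by rewrite !divr_gt0 ?exprn_gt0 //; lra.
by lra.
Qed.

(** The letter 1 at index k alone accounts for this decrease, and no other letter contributes an
    increase. *)
Lemma wval_base_slope b b' w k : 1 < b -> b <= b' -> w k = true ->
  (b' - b) / b' ^+ k.+2 <= wval b w - wval b' w.
Proof.
move=> b1 bb'; have b'1 : 1 < b' by lra.
have b0 : 0 < b by lra. have b'0 : 0 < b' by lra.
have iV : b'^-1 <= b^-1 by rewrite lef_pV2 ?posrE.
have le n v : wval b' v <= wval b v + (1 / (b' - 1)) / b ^+ n.
  elim: n v => [|n IH] v.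
    by have := wval_bounds v b1; have := wval_bounds v b'1; rewrite expr0 divr1; lra.
  rewrite (wval_cons v b1) (wval_cons v b'1) exprSr invfM mulrA -mulrDl.
  have := IH (stail 1 v); have := wval_bounds (stail 1 v) b'1.
  set x := wval b' _; set y := wval b _ + _; move=> /andP[x0 _] xy.
  apply: (@le_trans _ _ (((v 0%N)%:R + x) / b)).
    by rewrite ler_wpM2l // addr_ge0.
  by rewrite ler_pM2r ?invr_gt0 // -addrA lerD2l.
have {}le v : wval b' v <= wval b v.
  apply/ler_addgt0Pr => e e0; have b'10 : 0 < b' - 1 by lra.
  have [n bn] := exprV_small b1 (mulr_gt0 e0 b'10).
  apply: le_trans (le n v) _; rewrite lerD2l mulrAC ler_pdivrMr //.
  by rewrite mul1r ltW.
elim: k w => [|k IH] w wk; rewrite (wval_cons w b1) (wval_cons w b'1).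
  have := le (stail 1 w); have := wval_bounds (stail 1 w) b'1; rewrite wk.
  set x := wval b' _; set y := wval b _ => /andP[x0 _] xy.
  have -> : (b' - b) / b' ^+ 2 = (b^-1 - b'^-1) * (b / b').
    by rewrite expr2; field; apply/andP; split; lra.
  have bb : b / b' <= 1 by rewrite ler_pdivrMr //=; lra.
  have : x / b' <= y / b.
    by apply: ler_pM => //; rewrite invr_ge0 ltW.
  have p0 : 0 <= b^-1 - b'^-1 by rewrite subr_ge0.
  move=> xy'; apply: le_trans (ler_piMr p0 bb) _.
  have -> : (true%:R + y) / b - (true%:R + x) / b' = b^-1 - b'^-1 + (y / b - x / b').
    by rewrite /=; ring.
  by rewrite lerDl subr_ge0.
have := IH (stail 1 w); rewrite /stail add1n => /(_ wk).
rewrite -/(stail 1 w); have := wval_bounds (stail 1 w) b1.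
have := le (stail 1 w).
set x := wval b' _; set y := wval b _ => xy /andP[y0 _] S.
have y' : y / b' <= y / b by rewrite ler_wpM2l.
have w0 : (w 0%N)%:R / b' <= (w 0%N)%:R / b :> R by rewrite ler_wpM2l.
rewrite exprSr invfM mulrA; apply: (@le_trans _ _ ((y - x) / b')).
  by rewrite ler_pM2r ?invr_gt0.
by rewrite !mulrDl mulNr; lra.
Qed.

Lemma le_wval_base b b' w : 1 < b -> b <= b' -> wval b' w <= wval b w.
Proof.
move=> b1 bb'; have [[k wk]|w0] := pselect (exists k, w k = true).
  have := wval_base_slope b1 bb' wk.
  have : 0 <= (b' - b) / b' ^+ k.+2; last lra.
  by rewrite divr_ge0 ?exprn_ge0 //; lra.
have -> : w = fun=> false.
  by apply/funext => k; case wk : (w k) => //; case: w0; exists k.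
by rewrite !wval_cst0 //; lra.
Qed.

Lemma wval_compl b w : 1 < b -> wval b w + wval b (negb \o w) = 1 / (b - 1).
Proof.
move=> b1; have b0 : 0 < b by lra.
apply/eqP; rewrite -subr_eq0; apply/eqP.
apply: (@norm_le_expr_eq0 _ b _ (1 / (b - 1)) b1) => n.
elim: n w => [|n IH] w.
  rewrite expr0 divr1 ler_norml.
  have := wval_bounds w b1; have := wval_bounds (negb \o w) b1; lra.
rewrite (wval_cons w b1) (wval_cons (negb \o w) b1).
have -> : ((w 0%N)%:R + wval b (stail 1 w)) / b +
  (((negb \o w) 0%N)%:R + wval b (stail 1 (negb \o w))) / b - 1 / (b - 1) =
  (wval b (stail 1 w) + wval b (negb \o stail 1 w) - 1 / (b - 1)) / b.
  by rewrite /=; case: (w 0%N) => /=; field; apply/andP; split; lra.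
rewrite normrM normfV (gtr0_norm b0) exprSr invfM mulrA.
by rewrite ler_pM2r ?invr_gt0.
Qed.

(** The letter of index k has weight (b-1)/b^(k+2), which does not increase for b >= 2 because
    (b-1)/b^2 does not. *)
Lemma weighted_wval_nonincreasing b b' w : 2 <= b -> b <= b' ->
  (b' - 1) / b' * wval b' w <= (b - 1) / b * wval b w.
Proof.
move=> b2 bb'; have b1 : 1 < b by lra. have b'1 : 1 < b' by lra.
have b0 : 0 < b by lra. have b'0 : 0 < b' by lra.
have iV : b'^-1 <= b^-1 by rewrite lef_pV2 ?posrE.
pose D c v := (c - 1) / c * wval c v.
have D0 c v : 1 < c -> 0 <= D c v.
  move=> c1; have /andP[? _] := wval_bounds v c1.
  by rewrite mulr_ge0 // divr_ge0; lra.
have coef : (b' - 1) / b' / b' <= (b - 1) / b / b.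
  have -> : (b - 1) / b / b =
      (b' - 1) / b' / b' + (b' - b) * ((b - 1) * (b' - 1) - 1) / (b * b * (b' * b')).
    by field; apply/andP; split; lra.
  rewrite lerDl divr_ge0 ?mulr_ge0 ?(ltW b0) ?(ltW b'0) //; first lra.
  by nra.
have le n v : D b' v <= D b v + 1 / b ^+ n.
  elim: n v => [|n IH] v.
    have := D0 b v b1; have : D b' v <= 1; last by rewrite expr0 divr1; lra.
    have /andP[_ h] := wval_bounds v b'1.
    apply: (@le_trans _ _ ((b' - 1) / b' * (1 / (b' - 1)))).
      by rewrite ler_wpM2l // divr_ge0; lra.
    have -> : (b' - 1) / b' * (1 / (b' - 1)) = b'^-1 by field; apply/andP; split; lra.
    by rewrite invf_le1 // ltW.
  have DE c : 1 < c -> D c v = (c - 1) / c / c * (v 0%N)%:R + D c (stail 1 v) / c.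
    by move=> c1; rewrite /D (wval_cons v c1); field; lra.
  rewrite !DE // exprSr invfM mulrA -addrA -mulrDl.
  apply: lerD; first by rewrite ler_wpM2r.
  apply: (@le_trans _ _ (D b' (stail 1 v) / b)).
    by rewrite ler_wpM2l // D0.
  by rewrite ler_pM2r ?invr_gt0.
apply/ler_addgt0Pr => e e0; have [n bn] := exprV_small b1 e0.
by apply: le_trans (le n w) _; rewrite lerD2l mul1r ltW.
Qed.

Definition upper_curve w b : R := (b - 1) * (1 + wval b w).

(** In terms of the complementary word the curve is b, minus 1 - 1/b if w starts with 0, minus a
    weighted value that does not increase. As 1 - 1/b has slope at most 1/4 for b >= 2, slope 3/4
    remains. *)
Lemma upper_curve_slope b b' w : 2 <= b -> b <= b' ->
  3 / 4 * (b' - b) <= upper_curve w b' - upper_curve w b.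
Proof.
move=> b2 bb'; pose D c v := (c - 1) / c * wval c v.
have E c : 1 < c -> upper_curve w c =
    c - (1 - c^-1) * (~~ w 0%N)%:R - D c (stail 1 (negb \o w)).
  move=> c1; have := wval_compl w c1; rewrite (wval_cons (negb \o w) c1) /= => xE.
  rewrite /upper_curve /D; move: xE; set z := wval c (stail 1 _) => xE.
  have -> : wval c w = 1 / (c - 1) - ((~~ w 0%N)%:R + z) / c by rewrite -xE addrK.
  by field; apply/andP; split; lra.
rewrite !E; [|lra|lra].
have := @weighted_wval_nonincreasing b b' (stail 1 (negb \o w)) b2 bb'.
rewrite -/(D b _) -/(D b' _) => DD.
have ib : 0 <= b^-1 - b'^-1 <= (b' - b) / 4.
  have -> : b^-1 - b'^-1 = (b' - b) / (b * b') by field; apply/andP; split; lra.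
  rewrite divr_ge0 ?mulr_ge0 /=; [|lra..].
  by apply: ler_wpM2l; rewrite ?lef_pV2 ?posrE; nra.
by case: (~~ w 0%N) => /=; lra.
Qed.

End BinaryValues.

(** * Admissible sequences and the curves of sigma *)

Section Admissible.
Variable R : realType.
Implicit Types (b c m x : R) (v w : nat -> bool).

Definition admissible m b : set (nat -> bool) :=
  [set w | (exists k, w k = true) /\
           forall v, tail1 w v -> m / (b - 1) - 1 < wval b v < m - 1].

Lemma admissible_stail m b w k : admissible m b w ->
  (exists i, stail k w i = true) -> admissible m b (stail k w).
Proof. by move=> [_ H] w1; split=> // v /tail1_stail /H. Qed.

(** For b > 2 all tails are at most 1/(b-1) < 1, so the letters 0 are forced as well. *)
Lemma admissible_unique m b w : 1 < m <= 2 -> 2 < b -> admissible m b w ->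
  exists2 u, unique_expansions b (ternary m) u & ~ trivial_expansions (ternary m) u.
Proof.
move=> m12 b2 [[k wk] tw]; have b1 : 1 < b by lra.
exists (fun k => (w k)%:R).
  apply: unique_expansionsI => // j.
    by case: (w j); [left; right|left; left].
  have /andP[_] := wval_bounds (stail j.+1 w) b1.
  have : 1 / (b - 1) < 1 by rewrite ltr_pdivrMr; lra.
  case wj : (w j) => h1 h2; split=> /=; try lra; last by move=> _; exact: le_lt_trans h2 h1.
  by move=> _; apply: tw; exists j.
rewrite trivial_expansions_ternary; last lra.
by case=> /(congr1 (fun f => f k)); rewrite wk /=; lra.
Qed.

(** As (b-1)^2 < m, the words 0m, 1m and m0 cannot occur in u. So u is a run of letters m followed
    by a word over {0,1}, which contains a 1 because u is nontrivial. *)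
Lemma unique_admissible m b u : 1 < m <= 2 -> 1 < b -> (b - 1) ^+ 2 < m ->
  unique_expansions b (ternary m) u -> ~ trivial_expansions (ternary m) u ->
  2 < b /\ exists w, admissible m b w.
Proof.
move=> m12 b1 bm Uu; have b1m : 1 < b <= 1 + m.
  by rewrite b1 /= leNgt; apply/negP => lt; move: bm; rewrite expr2; nra.
have m1 : 1 < m by lra.
rewrite trivial_expansions_ternary // => nu.
have Au := Uu.1; have du := ternary_digits m1 Au.
pose X k := expansion_value b (stail k u).
have F k : forced m b (u k) (X k.+1) := unique_expansions_forced k m12 b1m Uu.
have XE k : b * X k = u k + X k.+1.
  rewrite /X (expansion_value_cons b1 (digits_stail k du)) stail_stail addn1 stail_at0.
  by rewrite mulrC divfK // gt_eqF // (lt_trans _ b1).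
have K1 : m / (b - 1) * (b - 1) = m by rewrite divfK //; lra.
have K0 : 0 < m / (b - 1) by rewrite divr_gt0; lra.
have s0 : 0 < b - 1 by rewrite subr_gt0.
have s2 : 0 <= (2 - m) * (b - 1) ^+ 2 by rewrite mulr_ge0 ?sqr_ge0; lra.
have s1 : 0 <= (2 - m) * (b - 1) by rewrite mulr_ge0; lra.
have not_0m x y : m / (b - 1) - (m - 1) < y -> x < 1 -> b * x <> m + y.
  move=> hy; rewrite -(ltr_pM2l (lt_trans ltr01 b1)) => hx E.
  have : m / (b - 1) < b - 1 by lra.
  by rewrite -(ltr_pM2r s0) K1 -expr2; lra.
have not_1m x y : m / (b - 1) - (m - 1) < y -> x < m - 1 -> b * x <> m + y.
  move=> hy; rewrite -(ltr_pM2l (lt_trans ltr01 b1)) => hx E.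
  have : 1 + m / (b - 1) < b * (m - 1) by lra.
  by rewrite -(ltr_pM2r s0) mulrDl K1; lra.
have not_m0 x y : y < 1 -> m / (b - 1) - (m - 1) < x -> b * x <> 0 + y.
  move=> hy; rewrite -(ltr_pM2l (lt_trans ltr01 b1)) => hx E.
  have bK : b * (m / (b - 1)) = m + m / (b - 1) by field; lra.
  have : m / (b - 1) < (b - 1) * (m - 1) by lra.
  by rewrite -(ltr_pM2r s0) K1; lra.
have to_m k : u k <> m -> u k.+1 <> m.
  move=> ukm uk1; have := F k; have := F k.+1; have := XE k.+1; rewrite uk1.
  move=> E [_ _ /(_ erefl) h] [h0 h1 _]; have [[uk|uk]|//] := Au k.
    exact: not_0m h (h0 uk) E.
  by have /andP[_ h1'] := h1 uk; exact: not_1m h h1' E.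
have m_to_0 k : u k = m -> u k.+1 <> 0.
  move=> ukm uk1; have := F k; have := F k.+1; have := XE k.+1; rewrite uk1 ukm.
  by move=> E [/(_ erefl) h _ _] [_ _ /(_ erefl) h']; exact: not_m0 h h' E.
have [k0 uk0] : exists k0, u k0 != m.
  apply: contrapT => /forallNP H; apply: nu; right; apply/funext => k.
  by apply/eqP; apply: contrapT => /negP; exact: H.
have [{uk0}k uk min] := @ex_minnP (fun k => u k != m) (ex_intro _ k0 uk0).
have uj j : u (k + j)%N <> m.
  by elim: j => [|j /to_m]; rewrite ?addn0 ?addnS //; exact/eqP.
pose w j := u (k + j)%N == 1.
have wE j : (w j)%:R = u (k + j)%N.
  rewrite /w; have [[|]|/uj//] := Au (k + j)%N => /= ->; first by rewrite eq_sym oner_eq0.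
  by rewrite eqxx.
have w1 : exists j, w j = true.
  case: k uk min uj @w wE => [|k] uk min uj w wE.
    apply: contrapT => /forallNP H; apply: nu; left; apply/funext => j.
    by rewrite -[LHS]wE; case: (w j) (H j).
  exists 0%N; rewrite /w addn0.
  have /eqP ukm : u k == m by apply: contrapT => /negP /min; rewrite ltnn.
  by have [[/= u0|/= ->]|/= u1] := Au k.+1; [have := m_to_0 _ ukm u0|rewrite eqxx|
    move: uk; rewrite u1 eqxx].
have aw : admissible m b w.
  split=> // v [j wj <-].
  have [_ + _] := F (k + j)%N; rewrite -wE wj => /(_ erefl).
  rewrite /X /wval; suff -> : stail (k + j).+1 u = fun i => (stail j.+1 w i)%:R by [].
  by apply/funext => i; rewrite /stail wE addnA addnS.
split; last by exists w.
(* The window m/(b-1) - 1 < x < m - 1 is nonempty, which forces b > 2. *)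
have [j wj] := w1; have := aw.2 _ (ex_intro2 _ _ j wj erefl).
move: (wval _ _) => x hx; have : m / (b - 1) < m by lra.
by rewrite ltr_pdivrMr; nra.
Qed.

(** Compactness: a prefix shared by infinitely many [t k] extends by one letter to another such
    prefix. *)
Lemma limit_word (t : nat -> nat -> bool) :
  exists w, forall n K, exists k, (K <= k)%N /\ forall i, (i < n)%N -> t k i = w i.
Proof.
pose often (s : seq bool) := forall K, exists k, (K <= k)%N /\ mkseq (t k) (size s) = s.
have step s : often s -> {a | often (rcons s a)}.
  move=> os; apply: cid; apply: contrapT => /forallNP H.
  have /existsNP[K1 H1] := H true; have /existsNP[K0 H0] := H false.
  have [k [kK E]] := os (maxn K0 K1); move: kK; rewrite geq_max => /andP[k0 k1].
  have S : mkseq (t k) (size s).+1 = rcons s (t k (size s)) by rewrite mkseqS E.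
  case tk : (t k (size s)) S => S; [apply: H1|apply: H0];
    by exists k; split=> //; rewrite size_rcons.
have o0 : often [::] by move=> K; exists K.
pose next (p : {s | often s}) : {s | often s} :=
  exist _ (rcons (sval p) (sval (step _ (svalP p)))) (svalP (step _ (svalP p))).
pose p n := iter n next (exist _ [::] o0).
have szp n : size (sval (p n)) = n by elim: n => //= n IH; rewrite size_rcons IH.
pose w n := nth false (sval (p n.+1)) n.
have pE n : sval (p n) = mkseq w n.
  elim: n => // n IH; rewrite mkseqS -IH /w /= nth_rcons szp ltnn eqxx //.
exists w => n K; have [k [Kk E]] := svalP (p n) K.
exists k; split=> // i iN; move: E; rewrite szp pE => /(congr1 (fun s => nth false s i)).
by rewrite !nth_mkseq.
Qed.

(* Choosing letters backwards, 1 in front of the tails below c and 0 in front of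
   the others, and passing to a limit. *)
Lemma threshold_word b c : 1 < b -> exists w, forall i,
  (w i = true -> wval b (stail i.+1 w) <= c) /\
  (w i = false -> c <= wval b (stail i.+1 w)).
Proof.
move=> b1; pose t n := iter n (fun v => scons (wval b v < c) v) (fun=> false).
have tE k i : (i < k)%N -> t k i = (wval b (stail i.+1 (t k)) < c).
  elim: k i => // k IH [_|i ik] /=; first by [].
  by rewrite -/(t k) IH.
have [w wt] := limit_word t.
have approx i e : 0 < e -> exists k, w i = (wval b (stail i.+1 (t k)) < c) /\
    `|wval b (stail i.+1 (t k)) - wval b (stail i.+1 w)| < e.
  move=> e0; have [n bn] : exists n, (b ^+ n)^-1 < e * (b - 1).
    by apply: exprV_small => //; rewrite mulr_gt0 // subr_gt0.
  have [k [ik tw]] := wt (i.+1 + n)%N i.+1.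
  exists k; split; first by rewrite -tE // tw // leq_addr.
  apply: le_lt_trans (wval_agree (n := n) b1 _) _ => [j jn|].
    by rewrite /stail tw ?ltn_add2l.
  by rewrite mulrAC mul1r ltr_pdivrMr ?subr_gt0.
exists w => i; split=> wi; rewrite leNgt; apply/negP; rewrite -subr_gt0;
  move=> /(approx i)[k [+ h]]; rewrite wi => /esym.
- by move: h; rewrite ltr_norml; lra.
- by move=> /negbT; rewrite -leNgt; move: h; rewrite ltr_norml; lra.
Qed.

Lemma admissible_large m b : 1 < m <= 2 -> 2 < b -> m < (b - 1) ^+ 2 ->
  exists w, admissible m b w.
Proof.
move=> m12 b2 bm; have b1 : 1 < b by lra.
have b0 : 0 < b by lra.
set K := m / (b - 1); have KE : K * (b - 1) = m by rewrite divfK //; lra.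
have Kb : K < b - 1 by rewrite ltr_pdivrMr ?subr_gt0 // -expr2.
pose C := b * (K - 1); have CB : C < m - 1 by rewrite /C; nra.
(* A tail after a 1 is at most c < m - 1. If it starts with 0, what follows is at least c > C; if it
   starts with 1, it is at least 1/b > C/b. Either way it exceeds C/b = m/(b-1) - 1. As c > 0, the
   word is not 0^oo. *)
pose c := (Num.max C 0 + (m - 1)) / 2.
have [Cc c0 cB] : [/\ C < c, 0 < c & c < m - 1].
  by rewrite /c; case: (ltP C 0) => ?; split; lra.
have [w wc] := threshold_word c b1.
exists w; split.
  apply: contrapT => /forallNP H.
  have w0 : w = fun=> false by apply/funext => k; case wk : (w k) => //; case: (H k).
  have := (wc 0%N).2; rewrite w0 => /(_ erefl).
  by rewrite (_ : stail 1 _ = fun=> false) // wval_cst0 //; lra.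
move=> v [k wk <-]; have := (wc k).1 wk; set x := wval b _ => xc.
apply/andP; split; last lra.
rewrite -(ltr_pM2l b0) -/C.
have := wval_tail w k.+1 b1; rewrite -/x.
case wk1 : (w k.+1) => /= E; last by have := (wc k.+1).2 wk1; lra.
have := wval_bounds (stail k.+2 w) b1; lra.
Qed.

(** Tails after a 0 exceed b(m/(b-1) - 1), tails after a 1 are below m - 1, and these bounds differ
    by m/(b-1) - (b-1) > 0. Starting with a 1 ensures that every 0 has a 1 before it. *)
Lemma admissible_gap m b : 2 < b -> (b - 1) ^+ 2 < m ->
  exists N, gap N [set w | admissible m b w /\ w 0%N = true].
Proof.
move=> b2 bm; have b1 : 1 < b by lra.
set K := m / (b - 1); have KE : K * (b - 1) = m by rewrite divfK //; lra.
have Kb : b - 1 < K by rewrite ltr_pdivlMr ?subr_gt0 // -expr2.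
have [N bN] : exists n, (b ^+ n)^-1 < K - (b - 1).
  by apply: exprV_small => //; rewrite subr_gt0.
exists N => w w' i j [[_ tw] w0] [[_ tw'] _] wi w'j.
apply: (@lexlt_wval R b) => //.
have hi : wval b (stail j.+1 w') < m - 1.
  by have /andP[] := tw' _ (ex_intro2 _ _ j w'j erefl).
have tails k : K - 1 < wval b (stail k.+1 w).
  elim: k => [|k IH].
    by have /andP[] := tw _ (ex_intro2 _ _ 0%N w0 erefl).
  case wk : (w k.+1).
    by have /andP[] := tw _ (ex_intro2 _ _ k.+1 wk erefl).
  by rewrite (wval_tail w k.+1 b1) wk /= subr0; nra.
have lo : b * (K - 1) < wval b (stail i.+1 w).
  case: i wi => [|i] wi; first by rewrite w0 in wi.
  rewrite (wval_tail w i.+1 b1) wi /= subr0 ltr_pM2l; [exact: tails|lra].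
have : 1 / (b - 1) / b ^+ N < K - (b - 1).
  apply: le_lt_trans bN; rewrite ler_piMl ?invr_ge0 ?exprn_ge0 //; first lra.
  by rewrite ler_pdivrMr; lra.
by nra.
Qed.

(* [lower_curve hs] and [upper_curve (low hs)] are the two sides of the equation
   for beta_sigma, and [low hs] is admissible iff m lies strictly between them. *)
Definition lower_curve hs b : R := 1 + wval b (upp hs).

Definition between hs m b := lower_curve hs b < m < upper_curve (low hs) b.

Lemma upper_curveP w m b : 1 < b ->
  (m < upper_curve w b) = (m / (b - 1) - 1 < wval b w).
Proof.
by move=> b1; rewrite ltrBlDl ltr_pdivrMr ?subr_gt0 // mulrC.
Qed.

Lemma admissible_low hs m b : 2 < b -> between hs m b -> admissible m b (low hs).
Proof.
move=> b2 /andP[lo]; rewrite upper_curveP; last lra; move=> hi.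
split=> [|v /tail1_low_bounds[lv vu]].
  by have [k wk _] := tail1_low hs; exists k.
rewrite (lt_le_trans hi) ?wval_lexle ?(ltW b2) //=.
apply: le_lt_trans (wval_lexle (ltW b2) vu) _; move: lo; rewrite /lower_curve; lra.
Qed.

Lemma admissible_between hs m b w k : 1 < b -> admissible m b w ->
  stail k w = low hs -> between hs m b.
Proof.
move=> b1 [_ tw] E.
have wt v : tail1 (low hs) v -> tail1 w v by rewrite -E; exact: tail1_stail.
have /andP[_ lo] := tw _ (wt _ (tail1_low_upp hs)).
have /andP[hi _] := tw _ (wt _ (tail1_low hs)).
by rewrite /between upper_curveP // hi /lower_curve andbT; lra.
Qed.

Lemma admissible_between_exists m b w : 2 < b -> (b - 1) ^+ 2 < m ->
  admissible m b w -> exists hs, between hs m b.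
Proof.
move=> b2 bm aw; have b1 : 1 < b by lra.
have [[j wj] _] := aw; have [N] := admissible_gap b2 bm.
have w'0 : stail j w 0%N = true by rewrite stail_at0.
have aw' : admissible m b (stail j w) by apply: admissible_stail => //; exists 0%N.
move=> /gap_classification[H|[hs H]].
  by have := w'0; rewrite (H _ (conj aw' w'0)).
have [k E] := H _ (conj aw' w'0).
by exists hs; apply: admissible_between aw' E.
Qed.

Lemma between_mono hs m b b' : 2 <= b -> b <= b' -> between hs m b -> between hs m b'.
Proof.
move=> b2 bb' /andP[lo hi]; apply/andP; split.
  apply: le_lt_trans lo; rewrite lerD2l; apply: le_wval_base => //; lra.
apply: lt_le_trans hi _; have := @upper_curve_slope R b b' (low hs) b2 bb'; lra.
Qed.

(* Up to shifts, all sequences that are admissible at (m, b) are eventually equal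
   to a single [low h]; in particular [low hs] is a tail of [low hs']. *)
Lemma between_local hs hs' m b b' : 2 < b' -> b' <= b -> (b - 1) ^+ 2 < m ->
  between hs m b -> between hs' m b' -> between hs m b'.
Proof.
move=> b'2 bb' bm bhs b'hs'; have b2 : 2 < b by lra.
have [N] := admissible_gap b2 bm.
have adm h : between h m b ->
    exists j, admissible m b (stail j (low h)) /\ stail j (low h) 0%N = true.
  move=> bh; have [j wj _] := tail1_low h; exists j; rewrite stail_at0; split=> //.
  by apply: admissible_stail; [exact: admissible_low|exists 0%N; rewrite stail_at0].
have bhs' : between hs' m b by apply: between_mono b'hs' => //; lra.
have [j aj] := adm _ bhs; have [j' aj'] := adm _ bhs'.
move=> /gap_classification[H|[h H]].
  by have := aj.2; rewrite (H _ aj).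
have [k E] := H _ aj; have [k' E'] := H _ aj'.
have [i Ei] := low_recurrent hs (j + k).
apply: (@admissible_between hs m b' (low hs') (j' + k' + i)); first lra.
  exact: admissible_low.
by rewrite -!stail_stail E' -E !stail_stail addnA.
Qed.

End Admissible.

(** * The generalised golden ratio and its variation *)

Section GoldenRatio.
Variable R : realType.
Implicit Types (b m x y e : R).

Lemma lt_add1_sqrt b m : 1 <= b -> 0 < m ->
  (b < 1 + Num.sqrt m) = ((b - 1) ^+ 2 < m).
Proof.
move=> b1 m0; have b10 : 0 <= b - 1 by lra.
by rewrite -ltrBlDl -{1}(ger0_norm b10) -sqrtr_sqr ltr_sqrt.
Qed.

Definition bases m : set R := [set b | 2 < b /\ exists w, admissible m b w].

Lemma between_bases hs m b : 2 < b -> between hs m b -> bases m b.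
Proof. by move=> b2 bhs; split=> //; exists (low hs); exact: admissible_low. Qed.

Lemma bases_large m b : 1 < m <= 2 -> 1 < b -> m < (b - 1) ^+ 2 -> bases m b.
Proof.
move=> m12 b1 mb; have b2 : 2 < b by move: mb; rewrite expr2; nra.
by split=> //; exact: admissible_large.
Qed.

Lemma bases_up m b b' : 1 < m <= 2 -> bases m b -> b < b' -> bases m b'.
Proof.
move=> m12 [b2 [w aw]] bb'; have [bm|mb] := ltP ((b - 1) ^+ 2) m.
  have [hs bhs] := admissible_between_exists b2 bm aw.
  by apply: (@between_bases hs); [lra|apply: between_mono bhs; lra].
apply: bases_large => //; first lra.
by apply: le_lt_trans mb _; rewrite ltr_pXn2r ?nnegrE //; lra.
Qed.

(** The infimum has the defining property: below it a nontrivial unique expansion would yield an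
    admissible sequence, above it such sequences exist. In particular [golden_ratio] does not take
    its default value 0. *)
Lemma G_is_golden m : 1 < m <= 2 ->
  is_golden_ratio (ternary m) (G m) /\ G m = inf (bases m).
Proof.
move=> m12; suff H : is_golden_ratio (ternary m) (inf (bases m)).
  have HG : is_golden_ratio (ternary m) (G m).
    by rewrite /G /golden_ratio; case: xgetP => [x -> //|/(_ _ H)].
  by split=> //; exact: is_golden_ratio_uniq HG H.
have lb : has_lbound (bases m) by exists 2 => b [/ltW].
have ne : bases m !=set0.
  by exists 3; apply: bases_large => //; rewrite ?expr2; lra.
split.
- apply: (@lt_le_trans _ _ 2); first lra.
  by apply: lb_le_inf => // b [/ltW].
- move=> b /andP[b1 bG].
  have nb : ~ bases m b by move=> /(ge_inf lb); rewrite leNgt bG.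
  have bm : (b - 1) ^+ 2 < m.
    (* The midpoint b' turns (b'-1)^2 <= m into a strict inequality at b. *)
    have [bb' b'G] := midf_lt bG; set b' := (b + _) / 2 in bb' b'G.
    have : ~ bases m b' by move=> /(ge_inf lb); rewrite leNgt b'G.
    rewrite ltNge => nb'; apply/negP => mb; apply: nb'; apply: bases_large => //; first lra.
    by apply: le_lt_trans mb _; rewrite ltr_pXn2r ?nnegrE //; lra.
  apply/seteqP; split=> u; last first.
    apply: trivial_expansions_unique => //; rewrite b1 /= leNgt; apply/negP => lt.
    by move: bm; rewrite expr2; nra.
  move=> Uu; apply: contrapT => nu; apply: nb.
  by have [] := unique_admissible m12 b1 bm Uu nu.
- move=> b /(inf_lt ne)[b' bb' b'b].
  have [b2 [w aw]] := bases_up m12 bb' b'b.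
  exact: admissible_unique aw.
Qed.

Lemma G_le m b : 1 < m <= 2 -> bases m b -> G m <= b.
Proof.
move=> m12 bb; rewrite (G_is_golden m12).2; apply: ge_inf => //.
by exists 2 => x [/ltW].
Qed.

Lemma bases_neq0 m : 1 < m <= 2 -> bases m !=set0.
Proof. by exists 3; apply: bases_large => //; rewrite ?expr2; lra. Qed.

Lemma ge_G m x : 1 < m <= 2 -> (forall b, bases m b -> x <= b) -> x <= G m.
Proof.
by move=> m12 H; rewrite (G_is_golden m12).2; apply: lb_le_inf => //; exact: bases_neq0.
Qed.

Lemma G_lt m b : 1 < m <= 2 -> G m < b -> exists2 b', bases m b' & b' < b.
Proof. by move=> m12; rewrite (G_is_golden m12).2 => /(inf_lt (bases_neq0 m12)). Qed.

Lemma G_ge2 m : 1 < m <= 2 -> 2 <= G m.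
Proof. by move=> m12; apply: ge_G => // b [/ltW]. Qed.

Lemma G_le_sqrt m : 1 < m <= 2 -> G m <= 1 + Num.sqrt m.
Proof.
move=> m12; apply/ler_addgt0Pr => e e0; apply: G_le => //.
have m0 : 0 < m by lra. have s0 := sqrtr_ge0 m.
apply: bases_large => //.
  have : 0 < Num.sqrt m by rewrite sqrtr_gt0.
  lra.
rewrite -{1}(sqr_sqrtr (ltW m0)) ltr_pXn2r ?nnegrE //; lra.
Qed.

Lemma G_lt_between m : 1 < m <= 2 -> G m < 1 + Num.sqrt m ->
  forall e, 0 < e -> exists b hs,
    [/\ 2 < b, (b - 1) ^+ 2 < m, b < G m + e & between hs m b].
Proof.
move=> m12 Gm e e0.
have [|b [b2 [w aw]]] := @G_lt m (Num.min (G m + e) (1 + Num.sqrt m)) m12.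
  by rewrite lt_min Gm ltrDl e0.
rewrite lt_min => /andP[bG]; rewrite lt_add1_sqrt; [|lra|lra] => bm.
have [hs bhs] := admissible_between_exists b2 bm aw.
by exists b, hs.
Qed.

Lemma bases_between hs m b b' : (b - 1) ^+ 2 < m -> between hs m b ->
  b' <= b -> bases m b' -> between hs m b'.
Proof.
move=> bm bhs b'b [b'2 [w aw]].
have b'm : (b' - 1) ^+ 2 < m.
  by apply: le_lt_trans bm; rewrite ler_pXn2r ?nnegrE //; lra.
have [hs' bhs'] := admissible_between_exists b'2 b'm aw.
exact: between_local bhs bhs'.
Qed.

Lemma sqrt_lipschitz m m' : 1 <= m -> m <= m' -> Num.sqrt m' - Num.sqrt m <= (m' - m) / 2.
Proof.
move=> m1 mm'; have s1 : 1 <= Num.sqrt m by rewrite -sqrtr1 ler_sqrt; lra.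
have ss : Num.sqrt m <= Num.sqrt m' by rewrite ler_sqrt; lra.
have E : Num.sqrt m ^+ 2 = m by rewrite sqr_sqrtr; lra.
have E' : Num.sqrt m' ^+ 2 = m' by rewrite sqr_sqrtr; lra.
rewrite -{2}E -{2}E' subr_sqr; set a := Num.sqrt m' - _ in ss *.
rewrite -mulrA ler_peMr ?subr_ge0 // ler_pdivlMr; lra.
Qed.

(** If m grows by d, raising the base by 4/3 d keeps m below the upper curve, whose slope is at
    least 3/4, and the condition on the lower curve weakens. If G(m) = 1 + sqrt m, the bound G <= 1
    + sqrt suffices, with slope at most 1/2. *)
Lemma G_slope m m' : 1 < m -> m <= m' -> m' <= 2 ->
  G m' <= G m + 4 / 3 * (m' - m).
Proof.
move=> m1 mm' m'2; have m12 : 1 < m <= 2 by lra.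
have m'12 : 1 < m' <= 2 by lra.
have [Gm|Gm] := ltP (G m) (1 + Num.sqrt m); last first.
  have := G_le_sqrt m'12; have := sqrt_lipschitz (ltW m1) mm'; lra.
apply/ler_addgt0Pr => e e0.
have [b [hs [b2 bm bG bhs]]] := G_lt_between m12 Gm e0.
suff : G m' <= b + 4 / 3 * (m' - m) by lra.
apply: G_le => //; apply: (@between_bases hs); first lra.
have /andP[lo hi] := bhs; apply/andP; split.
  apply: (@le_lt_trans _ _ (lower_curve hs b)); last exact: lt_le_trans lo mm'.
  by rewrite lerD2l; apply: le_wval_base; lra.
have := @upper_curve_slope R b (b + 4 / 3 * (m' - m)) (low hs); lra.
Qed.

(** The upper curve exceeds m' at all bases above 2, so only the condition on the lower curve
    remains, and it weakens as m grows. The base b ensures that this sigma decides G(m). *)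
Lemma G_nonincreasing hs b m m' : 2 < b -> (b - 1) ^+ 2 < m ->
  lower_curve hs b < m -> m <= m' -> m' <= 2 -> m' <= upper_curve (low hs) 2 ->
  G m' <= G m.
Proof.
move=> b2 bm lo mm' m'2 hi.
have m1 : 1 < m by move: bm; rewrite expr2; nra.
have m12 : 1 < m <= 2 by lra. have m'12 : 1 < m' <= 2 by lra.
have hi2 c : 2 < c -> m' < upper_curve (low hs) c.
  by move=> c2; have := @upper_curve_slope R 2 c (low hs); lra.
have bhs : between hs m b by apply/andP; split=> //; apply: le_lt_trans mm' (hi2 _ b2).
apply: ge_G => // c; have [cb|bc _] := ltP c b; last first.
  apply: le_trans bc; apply: G_le => //; apply: (@between_bases hs) => //.
  by rewrite /between (lt_le_trans lo mm') hi2.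
move=> mc; have c2 := mc.1; have /andP[lo' _] := bases_between bm bhs (ltW cb) mc.
apply: G_le => //; apply: (@between_bases hs) => //.
by rewrite /between (lt_le_trans lo' mm') hi2.
Qed.

Lemma wval_block b n w : 1 < b ->
  wval b (block n w) = (1 + wval b w) / b ^+ n.+1.
Proof.
move=> b1; have b0 : b != 0 by lra.
elim: n => [|n IH]; first by rewrite wval_cons.
by rewrite wval_cons // blockS /= IH add0r [b ^+ n.+2]exprSr invfM mulrA.
Qed.

Lemma wval_cst1 b : 1 < b -> wval b (fun=> true) = 1 / (b - 1).
Proof. by move=> b1; rewrite /wval (@expansion_value_cst _ b 1) //= lexx ler01. Qed.

Lemma wval_tau b h : 1 < b ->
  wval b (tau_inf h (fun=> true)) = 1 / (b ^+ h.+1 - 1).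
Proof.
move=> b1; have bh : 1 < b ^+ h.+1 by rewrite exprn_egt1.
have := wval_block h (tau_inf h (fun=> true)) b1.
have <- : tau_inf h (fun=> true) = block h (tau_inf h (fun=> true)).
  by rewrite {1}tau_infE addn0.
set x := wval _ _ => /(congr1 ( *%R^~ (b ^+ h.+1))); rewrite divfK; last lra.
by move=> E; apply/(canRL (mulfK _)); lra.
Qed.

Lemma lower_curve_tau h b : 1 < b -> lower_curve [:: h] b = 1 + 1 / (b ^+ h.+1 - 1).
Proof.
move=> b1; rewrite /lower_curve /= -wval_tau //; congr (_ + wval _ (tau_inf _ _)).
by apply/funext => -[].
Qed.

Lemma upper_curve_tau h b : 1 < b ->
  upper_curve (low [:: h]) b = (b - 1) * (1 + 1 / (b ^+ h.+1 - 1)).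
Proof. by move=> b1; rewrite /upper_curve wval_tau. Qed.

End GoldenRatio.

(** * Total variation *)

Section TotalVariation.
Variable R : realType.
Implicit Types (a b x y : R) (f g : R -> R).

(* Write f as the sum of the nondecreasing g and the nonincreasing f - g. *)
Lemma variation_dominated a b f g s : itv_partition a b s ->
  (forall x y, a <= x -> x <= y -> y <= b -> 0 <= g y - g x) ->
  (forall x y, a <= x -> x <= y -> y <= b -> f y - f x <= g y - g x) ->
  variation a b f s <= 2 * (g b - g a) - (f b - f a).
Proof.
move=> pabs gx fx.
have gnd : {in `[a, b] &, nondecreasing_fun g}.
  by move=> x y; rewrite !in_itv /= => /andP[ax _] /andP[_ yb] /(gx _ _ ax)/(_ yb); lra.
have hnd : {in `[a, b] &, nonincreasing_fun (f \- g)}.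
  move=> x y; rewrite !in_itv /= => /andP[ax _] /andP[_ yb] /(fx _ _ ax)/(_ yb) /=; lra.
have -> : f = g \+ (f \- g) by apply/funext => x /=; lra.
apply: le_trans (variation_le _ _ _ _ _) _.
rewrite nondecreasing_variation // nonincreasing_variation //=; lra.
Qed.

(* G is nonincreasing on [13/10, 4/3] and on [16/9, 2], and grows
   with slope at most 4/3 elsewhere. *)
Definition majorant x : R :=
  4 / 3 * (Num.min x (13 / 10) +
           Num.max (Num.min x (16 / 9)) (4 / 3)).

Lemma majorant_nondecreasing x y : x <= y -> 0 <= majorant y - majorant x.
Proof.
move=> xy; rewrite /majorant.
have min_mono c : Num.min x c <= Num.min y c by rewrite le_min !ge_min xy lexx orbT.
have max_mono c c' : Num.max (Num.min x c) c' <= Num.max (Num.min y c) c'.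
  by rewrite ge_max !le_max min_mono lexx orbT.
by have := min_mono (13 / 10); have := max_mono (16 / 9) (4 / 3); lra.
Qed.

(** The interval is glued from pieces cut at 13/10, 4/3 and 16/9: on two of them slope 4/3 suffices,
    on the others a suitable sigma shows that G does not increase. *)
Lemma G_majorant x y : 1 < x -> x <= y -> y <= 2 ->
  G y - G x <= majorant y - majorant x.
Proof.
pose D x y := G y - G x <= majorant y - majorant x.
have glue a b c : (forall x y, a < x -> x <= y -> y <= b -> D x y) ->
    (forall x y, b <= x -> x <= y -> y <= c -> D x y) ->
    forall x y, a < x -> x <= y -> y <= c -> D x y.
  move=> ab bc {}x {}y ax xy yc; have [yb|/ltW b_y] := leP y b; first exact: ab.
  have [xb|/ltW bx] := leP x b; last exact: bc.
  have := ab _ _ ax xb (lexx b); have := bc _ _ (lexx b) b_y yc; rewrite /D; lra.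
have up x' y' : 1 < x' -> x' <= y' -> y' <= 2 ->
    4 / 3 * (y' - x') <= majorant y' - majorant x' -> D x' y'.
  by move=> x1 xy y2; have := G_slope x1 xy y2; rewrite /D; lra.
have down hs b x' y' : 2 < b -> (b - 1) ^+ 2 < x' ->
    lower_curve hs b < x' -> x' <= y' -> y' <= 2 -> y' <= upper_curve (low hs) 2 -> D x' y'.
  move=> b2 bx lo xy y2 hi; have := G_nonincreasing b2 bx lo xy y2 hi.
  have := majorant_nondecreasing xy; rewrite /D; lra.
have maj0 x' : x' <= 13 / 10 -> majorant x' = 4 / 3 * (x' + 4 / 3).
  by move=> ?; rewrite /majorant !min_l ?max_r; lra.
have maj1 x' : 4 / 3 <= x' -> x' <= 16 / 9 ->
    majorant x' = 4 / 3 * (x' + 13 / 10).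
  by move=> ? ?; rewrite /majorant min_r ?min_l ?max_l; lra.
apply: (glue _ (16 / 9)); last first.
  (* sigma = id: at b = 23/10 both (b-1)^2 = 1.69 and the lower curve 1 + 10/13 are below 16/9; the
     upper curve at 2 equals 2. *)
  move=> x' y' x'1 xy y2; apply: (down [::] (23 / 10)) => //; rewrite ?expr2; try lra.
  - rewrite /lower_curve /= wval_cst1; last lra.
    have -> : 1 / (23 / 10 - 1) = 10 / 13 :> R by field.
    lra.
  - rewrite /upper_curve /= wval_cst1; last lra.
    have -> : 2 - 1 = 1 :> R by lra.
    lra.
apply: (glue _ (4 / 3)); last first.
  by move=> x' y' x'1 xy y2; apply: up; rewrite ?maj1; lra.
apply: (glue _ (13 / 10)).
  by move=> x' y' x'1 xy y2; apply: up; rewrite ?maj0; lra.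
(* sigma = tau_1: at b = 21/10 both 1.21 and 1 + 100/341 are below 13/10; the upper curve at 2
   equals 4/3. *)
move=> x' y' x'1 xy y2; apply: (down [:: 1%N] (21 / 10)) => //; rewrite ?expr2; try lra.
- rewrite lower_curve_tau; last lra.
  have -> : 1 / ((21 / 10) ^+ 2 - 1) = 100 / 341 :> R by field.
  lra.
- rewrite upper_curve_tau; last lra.
  have -> : (2 - 1) * (1 + 1 / (2 ^+ 2 - 1)) = 4 / 3 :> R by field.
  lra.
Qed.

Lemma total_variation_G : (total_variation_on `]1, 2]%R (@G R) < 2%:E)%E.
Proof.
(* Twice the increase of [majorant] on [1, 2] is 268/135 < 199/100. *)
apply: (@le_lt_trans _ _ (199 / 100)%:E); last by rewrite lte_fin; lra.
apply: ge_ereal_sup => _ [a [b [s [+ + pabs ->]]]].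
rewrite !in_itv /= lee_fin => /andP[a1 a2] /andP[b1 b2].
apply: le_trans (variation_dominated (g := majorant) pabs _ _) _.
- by move=> x y _ + _; exact: majorant_nondecreasing.
- by move=> x y ax xy yb; apply: G_majorant; lra.
have := G_ge2 (m := b); have := G_le_sqrt (m := a).
have := sqrt_lipschitz (lexx 1) (ltW a1); rewrite sqrtr1.
have : majorant b <= majorant 2 by have := majorant_nondecreasing b2; lra.
have : majorant 2 = 4 / 3 * (277 / 90).
  by rewrite /majorant !min_r ?max_l; lra.
(* 4/3 * 7/3 is [majorant 1]; the surplus (a-1)/4, doubled, absorbs G a - G b <= (a-1)/2. *)
have : 4 / 3 * (7 / 3) + (a - 1) / 4 <= majorant a.
  have : 16 / 9 <= Num.max (16 / 9) (4 / 3) :> R by rewrite le_max lexx.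
  rewrite /majorant; case: (leP a (13 / 10)) => ?; case: (leP a (16 / 9)) => ?;
  case: (leP a (4 / 3)) => ?; lra.
by rewrite a1 a2 b1 b2; lra.
Qed.

End TotalVariation.

(** * Differentiability *)

Section Differentiability.
Variable R : realType.
Implicit Types (b c m x y l : R) (f : R -> R) (w : nat -> bool) (hs : seq nat).

Fixpoint wval_num w n : R -> R :=
  if n is p.+1 then id * wval_num w p + cst (w p)%:R else cst 0.

Lemma wval_numE b w n : 1 < b ->
  b ^+ n * wval b w = wval_num w n b + wval b (stail n w).
Proof.
move=> b1; elim: n => [|n IH]; first by rewrite expr0 mul1r /= add0r.
rewrite exprS -mulrA IH wval_tail // -[wval_num w n.+1 b]/(b * wval_num w n b + (w n)%:R).
by ring.
Qed.

(** For a word of period p + 1 the value is a rational function of the base, with denominator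
    b^(p+1) - 1. *)
Lemma derivable_wval w p b : 1 < b -> stail p.+1 w = w ->
  derivable (fun c => wval c w) b 1.
Proof.
move=> b1 wp.
have dnum n : derivable (wval_num w n) b 1.
  elim: n => [|n IH] /=; first exact: derivable_cst.
  apply: derivableD; last exact: derivable_cst.
  by apply: derivableM; [exact: derivable_id|exact: IH].
apply: (@near_eq_derivable _ _ _
    (wval_num w p.+1 * (fun c => ((id ^+ p.+1 - cst 1 : R -> R) c)^-1))).
  near=> c; have c1 : 1 < c by near: c; exact: lt_nbhsr.
  have cp : 1 < c ^+ p.+1 by rewrite exprn_egt1.
  have := wval_numE w p.+1 c1; rewrite wp => E.
  have idX : (id ^+ p.+1 : R -> R) c = c ^+ p.+1 by rewrite exprfctE.
  rewrite -[LHS]/(wval_num w p.+1 c * ((id ^+ p.+1) c - 1)^-1) idX.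
  move: E cp; move: (wval_num _ _ _) (c ^+ p.+1) => n q E q1.
  by apply/(canLR (mulfK _)); lra.
apply: derivableM => //; apply: derivableV; last first.
  by apply: derivableB; [apply: derivableX; exact: derivable_id|exact: derivable_cst].
have : 1 < b ^+ p.+1 by rewrite exprn_egt1.
by rewrite -[(id ^+ p.+1 - cst 1) b]/((id ^+ p.+1) b - 1) exprfctE /=; lra.
Unshelve. all: by end_near. Qed.

Lemma derivable_upper_curve hs b : 1 < b ->
  derivable (upper_curve (low hs)) b 1.
Proof.
move=> b1; have [p _ wp] := tail1_low hs.
apply: (@derivableM _ _ (fun c => c - 1) (fun c => 1 + wval c (low hs))).
  by apply: derivableB; [exact: derivable_id|exact: derivable_cst].
by apply: derivableD; [exact: derivable_cst|exact: derivable_wval wp].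
Qed.

Lemma derivable_lower_curve hs b : 1 < b -> derivable (lower_curve hs) b 1.
Proof.
move=> b1; have [p _ wp] := tail1_low hs; have [k _ E] := tail1_low_upp hs.
apply: derivableD; first exact: derivable_cst.
apply: (@derivable_wval _ p) => //.
by rewrite -E stail_stail addnC -stail_stail wp.
Qed.

Lemma lower_curve_slope hs : exists k, forall b b', 1 < b -> b <= b' ->
  (b' - b) / b' ^+ k <= lower_curve hs b - lower_curve hs b'.
Proof.
have [k uk] : exists k, upp hs k = true.
  by case: hs => [|h hs]; [exists 0%N|eexists; rewrite /= tau_infE; exact: block_eq].
exists k.+2 => b b' b1 bb'; have := wval_base_slope b1 bb' uk.
by rewrite /lower_curve; lra.
Qed.

Lemma lower_curve_decreasing hs b b' : 1 < b -> b < b' ->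
  lower_curve hs b' < lower_curve hs b.
Proof.
move=> b1 bb'; have [k H] := lower_curve_slope hs.
have := H b b' b1 (ltW bb'); have : 0 < (b' - b) / b' ^+ k; last lra.
by rewrite divr_gt0 ?exprn_gt0; lra.
Qed.

Lemma upper_curve_increasing w b b' : 2 <= b -> b < b' ->
  upper_curve w b < upper_curve w b'.
Proof. by move=> b2 bb'; have := upper_curve_slope w b2 (ltW bb'); lra. Qed.

(* The part of the graph of f, one of the two curves of hs, that belongs to the
   graph of the inverse function of G. *)
Definition active hs f b : Prop :=
  [/\ 2 < b, (b - 1) ^+ 2 < f b, lower_curve hs b < upper_curve (low hs) b & f b < 2].

(** G(m) <= b since sigma serves all larger bases. By [bases_between] at some c in (b, 1 + sqrt m),
    sigma would also serve any admissible base below b, and hence b itself. *)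
Lemma G_on_curve hs m b : 2 < b -> (b - 1) ^+ 2 < m -> m < 2 ->
  (forall c, b < c -> between hs m c) -> ~ between hs m b -> G m = b.
Proof.
move=> b2 bm m2 bet nbet.
have m1 : 1 < m by move: bm; rewrite expr2; nra.
have m12 : 1 < m <= 2 by lra.
have bs : b < 1 + Num.sqrt m by rewrite lt_add1_sqrt; lra.
have [bc cs] := midf_lt bs; set c := (b + _) / 2 in bc cs.
have cm : (c - 1) ^+ 2 < m by rewrite -lt_add1_sqrt; lra.
apply/eqP; rewrite eq_le; apply/andP; split.
  apply/ler_addgt0Pr => e e0; apply: G_le => //; apply: (@between_bases _ hs); first lra.
  by apply: bet; lra.
apply: ge_G => // d md; rewrite leNgt; apply/negP => db; apply: nbet.
have d2 := md.1.
have /between_mono : between hs m d by apply: (bases_between cm (bet _ bc)) md; lra.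
by apply; lra.
Qed.

Lemma G_lower_curve hs b : active hs (lower_curve hs) b -> G (lower_curve hs b) = b.
Proof.
move=> [b2 bm lu m2]; apply: (@G_on_curve hs) => //; last first.
  by rewrite /between ltxx.
move=> c bc; rewrite /between lower_curve_decreasing //=; last lra.
by apply: lt_trans lu _; apply: upper_curve_increasing; lra.
Qed.

Lemma G_upper_curve hs b : active hs (upper_curve (low hs)) b ->
  G (upper_curve (low hs) b) = b.
Proof.
move=> [b2 bm lu m2]; apply: (@G_on_curve hs) => //; last first.
  by rewrite /between ltxx andbF.
move=> c bc; rewrite /between upper_curve_increasing ?andbT //; last lra.
by apply: lt_trans lu; apply: lower_curve_decreasing; lra.
Qed.

Lemma derivable_continuous f b : derivable f b 1 -> {for b, continuous f}.
Proof. by move=> /derivable1_diffP /differentiable_continuous. Qed.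

Lemma cvg_sub1_sqr b : (c - 1) ^+ 2 @[c --> b] --> (b - 1) ^+ 2.
Proof.
have c1 : (c - 1) @[c --> b] --> b - 1 by apply: cvgB (cvg_cst _); exact: cvg_id.
exact: (cvgM c1 c1).
Qed.

Lemma active_near hs f b : (forall c, 1 < c -> derivable f c 1) ->
  active hs f b -> \forall c \near b, active hs f c.
Proof.
move=> df [b2 bm lu m2]; have b1 : 1 < b by lra.
have cf := derivable_continuous (df _ b1).
have cl := derivable_continuous (@derivable_lower_curve hs _ b1).
have cu := derivable_continuous (@derivable_upper_curve hs _ b1).
have csq := @cvg_sub1_sqr b.
near=> c; split.
- by near: c; exact: lt_nbhsr.
- rewrite -subr_gt0; near: c; apply: (cvgr_gt _ (cvgB cf csq)).
  by rewrite subr_gt0.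
- rewrite -subr_gt0; near: c; apply: (cvgr_gt _ (cvgB cu cl)).
  by rewrite subr_gt0.
- by near: c; exact: (cvgr_lt _ cf).
Unshelve. all: by end_near. Qed.

(** [active] is an open condition, so G is a left inverse of f near b and the inverse function rule
    applies. *)
Lemma is_derive_G hs f b l : (forall c, 1 < c -> derivable f c 1) ->
  (forall c, active hs f c -> G (f c) = c) ->
  active hs f b -> is_derive b 1 f l -> l != 0 ->
  is_derive (f b) 1 (@G R) l^-1.
Proof.
move=> df Gf ab dfb l0; apply: is_derive_inverse => //.
  by apply: filterS (active_near df ab) => c; exact: Gf.
have [b2 _ _ _] := ab.
near=> c; apply: derivable_continuous; apply: df; near: c; apply: lt_nbhsr; lra.
Unshelve. all: by end_near. Qed.

Lemma derive_neq0 f x c : derivable f x 1 -> 0 < c ->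
  (\forall y \near x, c * `|y - x| <= `|f y - f x|) -> 'D_1 f x != 0.
Proof.
move=> dfx c0 /nbhs_ballP[e /= e0 H]; rewrite -normr_gt0.
apply: lt_le_trans c0 _; rewrite /derive -(cvg_lim _ (cvg_norm dfx)) //.
apply: limr_ge; first exact: is_cvg_norm.
near=> h; have h0 : h != 0 by near: h; exact: nbhs_dnbhs_neq.
have he : `|h| < e by near: h; exact: dnbhs0_lt.
rewrite /= normrM normfV [leRHS]mulrC ler_pdivlMr ?normr_gt0 //.
have := H (h *: 1 + x); rewrite addrK /GRing.scale /= mulr1; apply.
by rewrite -ball_normE /= opprD addrCA subrr addr0 normrN.
Unshelve. all: by end_near. Qed.

Lemma derive_lower_curve_neq0 hs b : 1 < b -> 'D_1 (lower_curve hs) b != 0.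
Proof.
move=> b1; have [k H] := lower_curve_slope hs.
have bk : 0 < (b + 1) ^+ k by rewrite exprn_gt0; lra.
(* Staying below b + 1 makes the slope bound uniform. *)
apply: (@derive_neq0 _ _ (((b + 1) ^+ k)^-1)).
- exact: derivable_lower_curve.
- by rewrite invr_gt0.
have S c c' : 1 < c -> c <= c' -> c' <= b + 1 ->
    ((b + 1) ^+ k)^-1 * (c' - c) <= lower_curve hs c - lower_curve hs c'.
  move=> c1 cc' c'b; apply: le_trans (H _ _ c1 cc').
  have c'0 : 0 < c' by lra. have b0 : 0 < b + 1 by lra.
  rewrite mulrC ler_wpM2l ?subr_ge0 // lef_pV2 ?posrE ?exprn_gt0 //.
  by rewrite lerXn2r ?nnegrE // ltW.
have bb : b < b + 1 by lra.
apply: filterS2 (lt_nbhsr b1) (lt_nbhsl bb) => y y1 yb.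
have [yb'|/ltW by'] := leP y b.
  rewrite ler0_norm ?subr_le0 // opprB; apply: le_trans (ler_norm _); apply: S; lra.
rewrite ger0_norm ?subr_ge0 // distrC; apply: le_trans (ler_norm _); apply: S; lra.
Qed.

Lemma derive_upper_curve_neq0 hs b : 2 < b -> 'D_1 (upper_curve (low hs)) b != 0.
Proof.
move=> b2; apply: (@derive_neq0 _ _ (3 / 4)); [apply: derivable_upper_curve; lra|lra|].
apply: filterS (lt_nbhsr b2) => y y2.
have [yb'|/ltW by'] := leP y b.
  rewrite ler0_norm ?subr_le0 // opprB distrC; apply: le_trans (ler_norm _).
  by apply: upper_curve_slope; lra.
rewrite ger0_norm ?subr_ge0 //; apply: le_trans (ler_norm _).
by apply: upper_curve_slope; lra.
Qed.

Lemma ut_sumE hs b : ut_sum (sigma hs) b = lower_curve hs b.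
Proof. by rewrite /ut_sum ut_wordE. Qed.

Lemma is_betaE hs b : is_beta (sigma hs) b <->
  2 <= b /\ lower_curve hs b = upper_curve (low hs) b.
Proof. by rewrite /is_beta ut_sumE u_wordE. Qed.

Lemma curve_IVT f b b' v : 1 < b -> b <= b' -> (forall c, 1 < c -> derivable f c 1) ->
  f b <= v <= f b' \/ f b' <= v <= f b -> exists c, [/\ b <= c, c <= b' & f c = v].
Proof.
move=> b1 bb' df fv.
have [||c] := @IVT R f b b' v bb'.
- apply: derivable_within_continuous => c; rewrite in_itv /= => /andP[bc _].
  by apply: df; lra.
- by rewrite ge_min le_max; case: fv => /andP[-> ->]; rewrite ?orbT.
by rewrite in_itv /= => /andP[bc cb'] fc; exists c.
Qed.

(** The curves cross in [2, 3]: at 2 the upper one is not above the lower one because [low hs] <=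
    [upp hs]; at 3 it is at least 2 and the lower one at most 3/2. *)
Lemma beta_sigma hs : is_beta (sigma hs) (beta R (sigma hs)).
Proof.
suff [b Hb] : exists b, is_beta (sigma hs) b.
  by rewrite /beta; case: xgetP => [x -> //|/(_ _ Hb)].
pose f b := upper_curve (low hs) b - lower_curve hs b.
have df c : 1 < c -> derivable f c 1.
  by move=> c1; apply: derivableB; [exact: derivable_upper_curve|exact: derivable_lower_curve].
have f2 : f 2 <= 0.
  have : wval 2 (low hs) <= wval 2 (upp hs) :> R.
    by apply: wval_lexle => //; have [] := tail1_low_bounds (tail1_low_upp hs).
  by rewrite /f /upper_curve /lower_curve; lra.
have f3 : 0 <= f 3.
  have b1 : (1 : R) < 3 by lra.
  have := wval_bounds (low hs) b1; have := wval_bounds (upp hs) b1.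
  have -> : 1 / (3 - 1) = 1 / 2 :> R by congr (_ / _); lra.
  by rewrite /f /upper_curve /lower_curve; lra.
have h12 : (1 : R) < 2 by lra. have h23 : (2 : R) <= 3 by lra.
have [|b [b2 _ fb]] := curve_IVT (v := 0) h12 h23 df; first by left; rewrite f2 f3.
exists b; apply/is_betaE; split=> //; move: fb; rewrite /f; lra.
Qed.

(** Avoiding all mu_sigma thus excludes the end point m = 2. *)
Lemma mu_sigma_id : mu R (sigma [::]) = 2.
Proof.
have /is_betaE := beta_sigma [::]; rewrite /mu ut_sumE.
set b := beta _ _ => -[b2]; rewrite /lower_curve /upper_curve /= wval_cst1; last lra.
move=> E; have b0 : b - 1 != 0 by lra.
have : 1 + 1 / (b - 1) = b by rewrite E; field.
move=> E'; have : (b - 1) * (b - 1) = 1.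
  have := congr1 ( *%R^~ (b - 1)) E'; rewrite mulrDl divfK // => ?; lra.
by move=> sq; rewrite E'; nra.
Qed.

(** Some sigma has its curves around m at a base b < 1 + sqrt m, and they cross at beta_sigma < b.
    Between these bases m is a value of the lower curve if m < mu_sigma and of the upper one if m >
    mu_sigma; near m, G inverts that curve. *)
Lemma derivable_G m : 1 < m <= 2 -> ~ (@frakM R) m ->
  (forall hs, mu R (sigma hs) <> m) -> derivable (@G R) m 1.
Proof.
move=> m12 nM nmu.
have m2 : m < 2 by have := nmu [::]; rewrite mu_sigma_id => /eqP; rewrite eq_sym; lra.
have Gm : G m < 1 + Num.sqrt m.
  rewrite lt_neqAle G_le_sqrt // andbT; apply/eqP => E; exact: nM.
have [b [hs [b2 bm _ /andP[lo hi]]]] := G_lt_between m12 Gm ltr01.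
have /is_betaE[] := beta_sigma hs; have := nmu hs; rewrite /mu ut_sumE.
set b0 := beta _ _ => m0 b02 E0.
have b0b : b0 < b.
  rewrite ltNge; apply/negP; rewrite le_eqVlt => /predU1P[bE|bb0].
    by move: lo hi; rewrite bE; lra.
  have := lower_curve_decreasing hs (_ : 1 < b) bb0.
  have := upper_curve_increasing (low hs) (ltW b2) bb0; lra.
have b01 : 1 < b0 by lra.
have sq c : b0 <= c -> c <= b -> (c - 1) ^+ 2 < m.
  by move=> bc cb; apply: le_lt_trans bm; rewrite ler_pXn2r ?nnegrE //; lra.
have [lt|lt|E] := ltgtP m (lower_curve hs b0); last by case: m0.
- have [|c [bc cb fc]] := curve_IVT (v := m) b01 (ltW b0b) (@derivable_lower_curve hs).
    by right; rewrite !ltW.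
  have {}bc : b0 < c.
    by rewrite lt_neqAle bc andbT; apply/eqP => bc'; rewrite bc' fc ltxx in lt.
  have ac : active hs (lower_curve hs) c.
    split; rewrite ?fc //; [lra|apply: sq; lra|].
    by apply: lt_trans lt _; rewrite E0; exact: upper_curve_increasing.
  have c1 : 1 < c by lra.
  have := is_derive_G (@derivable_lower_curve hs) (@G_lower_curve hs) ac
    (derivableP (@derivable_lower_curve hs _ c1)) (derive_lower_curve_neq0 hs c1).
  by rewrite fc => -[].
- have [|c [bc cb fc]] := curve_IVT (v := m) b01 (ltW b0b) (@derivable_upper_curve hs).
    by left; rewrite -E0 !ltW.
  have {}bc : b0 < c.
    by rewrite lt_neqAle bc andbT; apply/eqP => bc'; move: lt; rewrite E0 bc' fc ltxx.
  have ac : active hs (upper_curve (low hs)) c.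
    split; rewrite ?fc //; [lra|apply: sq; lra|].
    by apply: lt_trans lt; apply: lower_curve_decreasing; lra.
  have c1 : 1 < c by lra.
  have := is_derive_G (@derivable_upper_curve hs) (@G_upper_curve hs) ac
    (derivableP (@derivable_upper_curve hs _ c1)) (derive_upper_curve_neq0 hs (_ : 2 < c)).
  by rewrite fc => -[]//; lra.
Qed.

End Differentiability.

(** * Unboundedness of the derivative *)

Section Unbounded.
Variable R : realType.
Implicit Types (b c m M : R).

Lemma derive_lower_curve_tau h b : 1 < b ->
  'D_1 (lower_curve [:: h]) b = - (h.+1%:R * b ^+ h / (b ^+ h.+1 - 1) ^+ 2).
Proof.
move=> b1; pose q : R -> R := id ^+ h.+1 - cst 1.
have qE c : q c = c ^+ h.+1 - 1 by rewrite -[q c]/((id ^+ h.+1 : R -> R) c - 1) exprfctE.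
have bh : 1 < b ^+ h.+1 by rewrite exprn_egt1.
have q0 : q b != 0 by rewrite qE; lra.
have dq : is_derive b 1 q (h.+1%:R * b ^+ h *: 1 - 0) by apply: is_deriveB.
have dg : is_derive b 1 (cst 1 + (fun y => (q y)^-1))
    (0 + - (q b) ^- 2 *: (h.+1%:R * b ^+ h *: 1 - 0)).
  by apply: is_deriveD; apply: is_deriveV.
rewrite -(@near_eq_derive _ _ _ (cst 1 + (fun y => (q y)^-1))).
  rewrite derive_val qE /GRing.scale /=; field; lra.
near=> c; have c1 : 1 < c by near: c; exact: lt_nbhsr.
by rewrite lower_curve_tau // -qE div1r.
Unshelve. all: by end_near. Qed.

(** At b = 2 the lower curve has a value in (1, 2], above (b-1)^2 = 1, and stays above (b-1)^2
    nearby. The upper curve is b - 1 times the lower one, hence larger for b > 2. *)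
Lemma active_lower_curve_tau h : exists2 e : R, 0 < e &
  forall b, 2 < b < 2 + e -> active [:: h] (lower_curve [:: h]) b.
Proof.
pose f : R -> R := lower_curve [:: h].
have h12 : (1 : R) < 2 by lra.
have pw : 2 <= 2 ^+ h.+1 :> R by rewrite exprS ler_peMr // exprn_ege1 //; lra.
have f2 : 1 < f 2 <= 2.
  rewrite /f lower_curve_tau // ltrDl divr_gt0 //=; last lra.
  have : 1 / (2 ^+ h.+1 - 1) <= 1 :> R by rewrite ler_pdivrMr; lra.
  lra.
have cf := derivable_continuous (@derivable_lower_curve R [:: h] _ h12).
have csq := @cvg_sub1_sqr R 2.
have : \forall b \near (2 : R), 0 < f b - (b - 1) ^+ 2.
  apply: (cvgr_gt _ (cvgB cf csq)).
  by rewrite subr_gt0 -/f expr2; lra.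
move=> /nbhs_ballP[e /= e0 H]; exists e => // b /andP[b2 be].
have fb : (b - 1) ^+ 2 < f b.
  by rewrite -subr_gt0; apply: H; rewrite -ball_normE /= ltr_norml; lra.
have fb0 : 0 < f b by apply: le_lt_trans fb; exact: sqr_ge0.
split=> //.
  have -> : upper_curve (low [:: h]) b = (b - 1) * f b.
    by rewrite upper_curve_tau ?/f ?lower_curve_tau //; lra.
  by rewrite -/f ltr_pMl //; lra.
have := lower_curve_decreasing [:: h] h12 b2; rewrite -/f; lra.
Qed.

Lemma countable_mu : countable [set mu R s | s in Sstar].
Proof.
apply: sub_countable (card_image_le _ _) _.
apply: sub_countable (card_image_le _ _) _; exact: countableP.
Qed.

(** G is a left inverse of f, so if f took all its values in C the interval would be countable, yet
    its measure is positive. *)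
Lemma exists_notin_countable (f : R -> R) (C : set R) x y : x < y ->
  countable C -> (forall b, x < b < y -> G (f b) = b) ->
  exists b, x < b < y /\ ~ C (f b).
Proof.
move=> xy countC Gf; apply: contrapT => /forallNP H.
have sub : `]x, y[%classic `<=` @G R @` C.
  move=> b /=; rewrite in_itv /= => xby; exists (f b); last exact: Gf.
  by apply: contrapT => nC; apply: (H b).
have count : countable (`]x, y[%classic : set R).
  apply: sub_countable (subset_card_le sub) _.
  by apply: sub_countable (card_image_le _ _) countC.
have := countable_lebesgue_measure0 count.
by rewrite lebesgue_measure_itv /= lte_fin xy => -[]; lra.
Qed.

Lemma unbounded_derive_G :
  ~ bounded_set (derive1 (@G R) @`
      ([set m : R | 1 < m <= 2] `\` (@frakM R `|` [set mu R s | s in Sstar]))).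
Proof.
move=> /(pinfty_ex_gt (real0 R))[M M0 HM].
(* With h + 1 = 2k and k > 2M: 4^k - 1 >= (k+1)^2 - 1 > 2kM = (h+1)M. *)
have [k kM] : exists k : nat, 2 * M < k%:R.
  by exists (Num.bound (2 * M)); apply: archi_boundP; lra.
have k0 : (0 < k)%N by rewrite -(ltr_nat R); lra.
pose h := (2 * k).-1; have hE : h.+1 = (2 * k)%N by rewrite /h prednK // muln_gt0.
have [e e0 act] := active_lower_curve_tau h.
have e2 : 2 < 2 + e by lra.
(* The value at b avoids all mu_sigma; it is not in [frakM] either, as G(m) = b < 1 + sqrt m. *)
have [|b [be bC]] := exists_notin_countable (f := lower_curve [:: h]) e2 countable_mu.
  by move=> b /act; exact: G_lower_curve.
have ab := act _ be; have [b2 bm _ m2] := ab; have Gb := G_lower_curve ab.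
set m := lower_curve [:: h] b in bC bm m2 Gb.
have m1 : 1 < m by move: bm; rewrite expr2; nra.
have b1 : 1 < b by lra.
have Dm : derive1 (@G R) m = ('D_1 (lower_curve [:: h]) b)^-1.
  have := is_derive_G (@derivable_lower_curve R [:: h]) (@G_lower_curve R [:: h]) ab
    (derivableP (@derivable_lower_curve R [:: h] _ b1)) (derive_lower_curve_neq0 [:: h] b1).
  by rewrite derive1E => -[].
have : `|derive1 (@G R) m| <= M.
  apply: HM; exists m => //; split; first by rewrite /= m1 ltW.
  move=> [[_ E]|//]; move: bm; rewrite -lt_add1_sqrt; [|lra|lra].
  by rewrite -E Gb ltxx.
apply/negP; rewrite -ltNge Dm derive_lower_curve_tau // normfV normrN.
have bh0 : 0 < b ^+ h by rewrite exprn_gt0; lra.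
have bh1 : 1 <= b ^+ h by rewrite exprn_ege1; lra.
(* Hence |G'(m)| = (b^(h+1) - 1)^2 / ((h+1) b^h) >= (b^(h+1) - 1)/(h+1) > M. *)
have bh : b ^+ h <= b ^+ h.+1 - 1 by rewrite exprS; nra.
have n0 : 0 < h.+1%:R :> R by rewrite ltr0n.
have pw : h.+1%:R * M < b ^+ h.+1 - 1.
  apply: (@lt_le_trans _ _ (2 ^+ h.+1 - 1)); last first.
    by rewrite lerB // lerXn2r ?nnegrE; lra.
  have : k.+1%:R <= 2 ^+ k :> R by rewrite -natrX ler_nat ltn_expl.
  rewrite hE natrM mulnC exprM expr2 -natr1.
  have : 0 < k%:R :> R by rewrite ltr0n.
  by nra.
rewrite gtr0_norm; last first.
  by rewrite divr_gt0 ?mulr_gt0 ?exprn_gt0 //; lra.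
rewrite invf_div ltr_pdivlMr ?mulr_gt0 // expr2 mulrA [M * _]mulrC.
apply: (@le_lt_trans _ _ (h.+1%:R * M * (b ^+ h.+1 - 1))).
  by rewrite ler_wpM2l // mulr_ge0 ?ltW.
by rewrite ltr_pM2r //; lra.
Qed.

End Unbounded.

Theorem theorem2 (R : realType) :
  let D : set R :=
    [set m : R | 1 < m <= 2] `\` (@frakM R `|` [set mu R s | s in Sstar]) in
  [/\ (forall m : R, D m -> derivable (@G R) m 1),
      ~ bounded_set (derive1 (@G R) @` D)
    & (total_variation_on `]1, 2]%R (@G R) < 2%:E)%E].
Proof.
move=> D; split; [move=> m [m12 nm]|exact: unbounded_derive_G|exact: total_variation_G].
apply: derivable_G => // [?|hs E]; apply: nm; [by left|right].
by exists (sigma hs) => //; exists hs.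
Qed.
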